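(* For every instance of the metric uncapacitated facility location problem, consider the solution produced by Algorithm $A1(\gamma_0)$ and the solution produced by the JMS algorithm (both described in the context). The cheaper of these two solutions has expected cost at most $1.5\,(F^*+C^* )$, i.e. at most $1.5$ times the cost of an optimal solution of the LP relaxation.
   Context: Metric uncapacitated facility location (UFL): a finite set $\mathcal{F}$ of facilities with opening costs $f_i \ge 0$, a finite set $\mathcal{C}$ of clients, and connection costs $c_{ij}\ge 0$ satisfying $c_{ij} \le c_{ij'} + c_{i'j'} + c_{i'j}$ for all $i,i'\in\mathcal{F}$, $j,j'\in\mathcal{C}$. A solution opens a set of facilities and connects each client to an open facility; cost = opening costs + connection costs. LP relaxation: minimize $\sum_{i,j} c_{ij}x_{ij} + \sum_i f_i y_i$ s.t. $\sum_i x_{ij}=1$, $x_{ij}\le y_i$, $x_{ij}\ge 0$; $F^*=\sum_i f_iy^*_i$, $C^*=\sum_{i,j}c_{ij}x^*_{ij}$ for an optimal LP solution $(x^*,y^* )$. $\gamma_0\approx1.67736$ is the unique positive solution of $\frac1e+e^{-\gamma_0}-(\gamma_0-1)(1-\frac1e+e^{-\gamma_0})=0$. Algorithm $A1(\gamma)$, $\gamma>1$: (1) solve the LP to get $(x^*,y^* )$. (2) Set $\tilde y=\gamma y^*$; for each client $j$ assign $\tilde x_{ij}$ greedily along facilities in nondecreasing order of $c_{ij}$, each up to $\tilde y_i$, until total 1; then split facilities into copies (same costs/distances) until no pair has $0<\bar x_{ij}<\bar y_i$, giving $(\bar x,\bar y)$; set $y^*_i=\bar y_i/\gamma$ for copies.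 (3) With $\mathcal{C}_j=\{i:\bar x_{ij}>0\}$, $D^C_{av}(j)=\sum_{i\in\mathcal{C}_j}c_{ij}y^*_i/\sum_{i\in\mathcal{C}_j}y^*_i$, $D^C_{max}(j)=\max_{i\in\mathcal{C}_j}c_{ij}$, and clients neighbors if they share a close facility: repeatedly pick an unclustered client minimizing $D^C_{av}+D^C_{max}$ as cluster center and cluster it with its unclustered neighbors. (4) For each center $j$ open exactly one $i\in\mathcal{C}_j$, chosen with probability $\bar x_{ij}$. (5) Open every other facility independently with probability $\bar y_i$. (6) Connect each client to a closest open facility. JMS algorithm (Jain–Mahdian–Saberi): every client $j$ has a budget $\alpha_j$, all starting at $0$ and increasing uniformly over time while $j$ is unconnected. An unconnected client $j$ offers $\max(0,\alpha_j-c_{ij})$ to each facility $i$; a connected client $j$, currently connected to $i'$, offers $\max(0,c_{i'j}-c_{ij})$ to $i$. When the total offer to an unopened facility $i$ reaches $f_i$, $i$ is opened, and every client with positive offer to $i$ (and every unconnected client with $\alpha_j\ge c_{ij}$) is (re)connected to $i$. When an unconnected client $j$ has $\alpha_j\ge c_{ij}$ for an already open facility $i$, it is connected to $i$ and its budget stops growing. The algorithm ends when all clients are connected. *)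

(* Defs.v *)
From HB Require Import structures.
From mathcomp Require Import all_boot all_order all_algebra.
From mathcomp Require Import reals sequences exp.

Set Implicit Arguments.
Unset Strict Implicit.
Unset Printing Implicit Defensive.

Import Order.TTheory GRing.Theory Num.Theory.
Local Open Scope ring_scope.

(** * Metric uncapacitated facility location and its LP relaxation *)

Definition ufl_metric (R : realType) (F C : finType) (c : F -> C -> R) : Prop :=
  forall (i i' : F) (j j' : C), c i j <= c i j' + c i' j' + c i' j.

(* Cost of opening S and connecting each client j to a j. *)
Definition solution_cost (R : realType) (F C : finType)
    (f : F -> R) (c : F -> C -> R) (S : {set F}) (a : C -> F) : R :=
  \sum_(i in S) f i + \sum_j c (a j) j.

Definition facility_cost (R : realType) (F : finType) (f y : F -> R) : R :=
  \sum_i f i * y i.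

Definition connection_cost (R : realType) (F C : finType)
    (c x : F -> C -> R) : R :=
  \sum_i \sum_j c i j * x i j.

Definition lp_feasible (R : realType) (F C : finType)
    (x : F -> C -> R) (y : F -> R) : Prop :=
  [/\ forall j, \sum_i x i j = 1,
      forall i j, x i j <= y i
    & forall i j, 0 <= x i j].

Definition lp_optimal (R : realType) (F C : finType)
    (f : F -> R) (c : F -> C -> R) (x : F -> C -> R) (y : F -> R) : Prop :=
  lp_feasible x y /\
  forall x' y', lp_feasible x' y' ->
    connection_cost c x + facility_cost f y
      <= connection_cost c x' + facility_cost f y'.

Definition is_gamma0 (R : realType) (g : R) : Prop :=
  0 < g /\
  (expR 1)^-1 + expR (- g)
    - (g - 1) * (1 - (expR 1)^-1 + expR (- g)) = 0.

(** * Algorithm A1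

    Both algorithms leave choices open (the order of equidistant facilities,
    the distribution of the other clients' shares when a facility is split,
    ties between candidate centers or between closest facilities, the order of
    simultaneous events).  They are therefore described by relations that admit
    every way of resolving these choices. *)

Fixpoint greedy_fill (R : realType) (F : finType)
    (yt : F -> R) (s : seq F) (r : R) (i : F) : R :=
  if s is k :: s' then
    let a := Num.min (yt k) r in
    if i == k then a else greedy_fill yt s' (r - a) i
  else 0.

Definition greedy_assignment (R : realType) (F C : finType)
    (c : F -> C -> R) (yt : F -> R) (xt : F -> C -> R) : Prop :=
  forall j, exists s : seq F,
    [/\ perm_eq s (enum F), sorted (fun i k => c i j <= c k j) s
      & forall i, xt i j = greedy_fill yt s 1 i].

(* A copy of the facility cp_origin, with values y-bar and x-bar. *)
Record copy (R : realType) (F C : finType) := Copy {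
  cp_origin : F;
  cp_y : R;
  cp_x : C -> R
}.

(* [p] has a client [j] with 0 < x-bar < y-bar and is split in two at [j]. *)
Definition split_copy (R : realType) (F C : finType)
    (p p1 p2 : copy R F C) : Prop :=
  exists j,
    [/\ 0 < cp_x p j < cp_y p,
        cp_origin p1 = cp_origin p /\ cp_origin p2 = cp_origin p,
        cp_y p1 = cp_x p j /\ cp_y p2 = cp_y p - cp_x p j,
        cp_x p1 j = cp_x p j /\ cp_x p2 j = 0
      & forall k, [/\ cp_x p1 k + cp_x p2 k = cp_x p k,
                      0 <= cp_x p1 k <= cp_y p1
                    & 0 <= cp_x p2 k <= cp_y p2]].

(* [split_run s s'] : s' is obtained from s by splitting copies until no pair
   with 0 < x-bar < y-bar is left. *)
Inductive split_run (R : realType) (F C : finType) :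
    seq (copy R F C) -> seq (copy R F C) -> Prop :=
| split_stop s :
    (forall k : 'I_(size s), forall j,
       ~~ (0 < cp_x (tnth (in_tuple s) k) j < cp_y (tnth (in_tuple s) k))) ->
    split_run s s
| split_more s1 p p1 p2 s2 s' :
    split_copy p p1 p2 ->
    split_run (s1 ++ p1 :: p2 :: s2) s' ->
    split_run (s1 ++ p :: s2) s'.

(* The instance and the fractional solution after splitting: its facilities
   are the positions in the list of copies. *)
Definition sp_f (R : realType) (F C : finType) (f : F -> R)
    (s : seq (copy R F C)) (k : 'I_(size s)) : R :=
  f (cp_origin (tnth (in_tuple s) k)).

Definition sp_c (R : realType) (F C : finType) (c : F -> C -> R)
    (s : seq (copy R F C)) (k : 'I_(size s)) (j : C) : R :=
  c (cp_origin (tnth (in_tuple s) k)) j.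

Definition sp_x (R : realType) (F C : finType)
    (s : seq (copy R F C)) (k : 'I_(size s)) (j : C) : R :=
  cp_x (tnth (in_tuple s) k) j.

Definition sp_y (R : realType) (F C : finType)
    (s : seq (copy R F C)) (k : 'I_(size s)) : R :=
  cp_y (tnth (in_tuple s) k).

Definition close (R : realType) (F C : finType)
    (xb : F -> C -> R) (j : C) : {set F} :=
  [set i | 0 < xb i j].

Definition D_av (R : realType) (F C : finType)
    (c xb : F -> C -> R) (ys : F -> R) (j : C) : R :=
  (\sum_(i in close xb j) c i j * ys i) / (\sum_(i in close xb j) ys i).

Definition D_max (R : realType) (F C : finType)
    (c xb : F -> C -> R) (j : C) : R :=
  \big[Num.max/0]_(i in close xb j) c i j.

Definition neighbors (R : realType) (F C : finType)
    (xb : F -> C -> R) (j : C) : {set C} :=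
  [set k | close xb j :&: close xb k != set0].

(* [clustering c xb ys U K] : K lists cluster centers that may be picked, in
   this order, when U is the set of unclustered clients. *)
Inductive clustering (R : realType) (F C : finType)
    (c xb : F -> C -> R) (ys : F -> R) : {set C} -> seq C -> Prop :=
| clustering_done : clustering c xb ys set0 [::]
| clustering_pick (U : {set C}) (j : C) (K : seq C) :
    j \in U ->
    (forall k, k \in U ->
       D_av c xb ys j + D_max c xb j <= D_av c xb ys k + D_max c xb k) ->
    clustering c xb ys (U :\: (j |: neighbors xb j)) K ->
    clustering c xb ys U (j :: K).

(* Probability that S is the set of opened facilities, given the centers K.
   Distinct centers have disjoint sets of close facilities, so the choices at
   the centers and at the remaining facilities can be made independently.
   y-bar can exceed 1 on a facility used by no client, which is then opened
   with probability 1 (and it can be negative only if there are no clients). *)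
Definition opening_prob (R : realType) (F C : finType)
    (xb : F -> C -> R) (yb : F -> R) (K : seq C) (S : {set F}) : R :=
  (\prod_(j <- K)
      \sum_(i in close xb j | S :&: close xb j == [set i]) xb i j) *
  \prod_(i | ~~ has (fun j => i \in close xb j) K)
      (let p := Num.max 0 (Num.min 1 (yb i)) in
       if i \in S then p else 1 - p).

(* [a S] connects each client to a closest facility of S. *)
Definition connects_closest (R : realType) (F C : finType)
    (c : F -> C -> R) (a : {set F} -> C -> F) : Prop :=
  forall S j, S != set0 ->
    a S j \in S /\ forall i, i \in S -> c (a S j) j <= c i j.

(* An execution of A1(g) from the LP solution (x, y): s is the list of copies
   after splitting, K the list of centers, and (S, a S) the solution produced
   when S is the random set of opened copies.  It is a solution of the split
   instance, in which every opened copy pays its own opening cost. *)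
Definition a1_run (R : realType) (F C : finType) (c : F -> C -> R) (g : R)
    (y : F -> R) (s : seq (copy R F C)) (K : seq C)
    (a : {set 'I_(size s)} -> C -> 'I_(size s)) : Prop :=
  [/\ exists2 xt : F -> C -> R,
        greedy_assignment c (fun i => g * y i) xt
        & split_run [seq Copy i (g * y i) (xt i) | i <- enum F] s,
      clustering (sp_c c (s := s)) (sp_x (s := s))
        (fun k : 'I_(size s) => sp_y k / g) setT K
    & connects_closest (sp_c c (s := s)) a].

(** * The JMS algorithm *)

(* jms_link j is the facility to which j is currently connected, if any. *)
Record jms_state (R : realType) (F C : finType) := JmsState {
  jms_open : {set F};
  jms_link : C -> option F;
  jms_budget : C -> R
}.

Definition jms_init (R : realType) (F C : finType) : jms_state R F C :=
  JmsState set0 (fun=> None) (fun=> 0).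

Definition jms_offer (R : realType) (F C : finType) (c : F -> C -> R)
    (st : jms_state R F C) (i : F) (j : C) : R :=
  if jms_link st j is Some i' then Num.max 0 (c i' j - c i j)
  else Num.max 0 (jms_budget st j - c i j).

Definition jms_can_open (R : realType) (F C : finType)
    (f : F -> R) (c : F -> C -> R) (st : jms_state R F C) (i : F) : bool :=
  (i \notin jms_open st) && (f i <= \sum_j jms_offer c st i j).

Definition jms_can_connect (R : realType) (F C : finType)
    (c : F -> C -> R) (st : jms_state R F C) (i : F) (j : C) : bool :=
  [&& i \in jms_open st, jms_link st j == None & c i j <= jms_budget st j].

Definition jms_do_open (R : realType) (F C : finType)
    (c : F -> C -> R) (st : jms_state R F C) (i : F) : jms_state R F C :=
  JmsState (i |: jms_open st)
    (fun j => if (0 < jms_offer c st i j) ||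
                 ((jms_link st j == None) && (c i j <= jms_budget st j))
              then Some i else jms_link st j)
    (jms_budget st).

Definition jms_do_connect (R : realType) (F C : finType)
    (st : jms_state R F C) (i : F) (j : C) : jms_state R F C :=
  JmsState (jms_open st)
    (fun k => if k == j then Some i else jms_link st k)
    (jms_budget st).

Definition jms_grow (R : realType) (F C : finType)
    (st : jms_state R F C) (d : R) : jms_state R F C :=
  JmsState (jms_open st) (jms_link st)
    (fun j => if jms_link st j is None then jms_budget st j + d
              else jms_budget st j).

(* Time passes only as long as no facility can be opened and no client can be
   connected, so that events take place at the very moment they are enabled. *)
Inductive jms_step (R : realType) (F C : finType)
    (f : F -> R) (c : F -> C -> R) (st : jms_state R F C) :
    jms_state R F C -> Prop :=
| jms_step_open i :
    jms_can_open f c st i -> jms_step f c st (jms_do_open c st i)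
| jms_step_connect i j :
    jms_can_connect c st i j -> jms_step f c st (jms_do_connect st i j)
| jms_step_grow d :
    0 < d ->
    (forall e, 0 <= e < d ->
       (forall i, ~~ jms_can_open f c (jms_grow st e) i) /\
       (forall i j, ~~ jms_can_connect c (jms_grow st e) i j)) ->
    jms_step f c st (jms_grow st d).

Inductive jms_reachable (R : realType) (F C : finType)
    (f : F -> R) (c : F -> C -> R) : jms_state R F C -> Prop :=
| jms_reachable_init : jms_reachable f c (jms_init R F C)
| jms_reachable_step st st' :
    jms_reachable f c st ->
    (exists j, jms_link st j = None) ->
    jms_step f c st st' ->
    jms_reachable f c st'.

(* The algorithm can end having opened S and connected each j to a j. *)
Definition jms_run (R : realType) (F C : finType)
    (f : F -> R) (c : F -> C -> R) (S : {set F}) (a : C -> F) : Prop :=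
  exists st, [/\ jms_reachable f c st, jms_open st = S
               & forall j, jms_link st j = Some (a j)].

(* Main.v *)
(** The opened facilities of A1 come in independent blocks (the clusters and the
    single remaining facilities), so the probability that nothing opens among
    given fractional shares of the facilities is a product over the blocks, at
    most the exponential of minus the total share.  Thinning the close and the
    distant facilities of a client to total shares 1 and gamma - 1, and comparing
    the distribution of the distance to the first opened share with a linear
    bound obtained from convexity of that product, gives expected connection cost
    (1 - 1/e) Dc + (1/e) Dd + e^-gamma (B - Dd), where Dc, Dd are the average
    close and distant distances and B = Dd + D_max + D_av bounds the detour
    through a neighbouring center.  By the choice of gamma0 this is at most
    1 + 2 e^-gamma0 times the fractional connection cost.

    JMS is analysed by dual fitting: its cost is at most the sum of the budgets,
    and for each facility i the budgets of any set of clients obey the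
    factor-revealing inequalities.  Replicating clients and averaging over 50
    blocks reduces these, for every number of clients, to one fixed linear
    program, for which an explicit dual solution proves the bifactor
    (274/247, 439/247) = (1.1093.., 1.7773..).  Running A1 with weight 11/16 and
    JMS with weight 5/16 yields 3/2. *)

From Stdlib Require Import BinNat Nnat.
Require Import Defs.
From HB Require Import structures.
From mathcomp Require Import all_boot all_order all_algebra.
From mathcomp Require Import reals sequences exp.
From mathcomp Require Import zify ring lra.

Set Implicit Arguments.
Unset Strict Implicit.
Unset Printing Implicit Defensive.

Import Order.TTheory GRing.Theory Num.Theory.
Local Open Scope ring_scope.

(** * Numerical bounds on gamma0 *)

(** The margin decides how sharp everything must be. If the JMS pair is rounded up to (1.11, 1.78),
    no weights bring both coefficients down to 3/2. With weights 11/16 and 5/16 the constants used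
    here leave about 10^-4 for F* and 2 * 10^-5 for C*, hence the tight rational bounds on gamma0
    and the exact integer certificate. What makes the JMS program small enough for such a
    certificate is the sequence [be]. The intermediate connection costs of k clients would give
    about k^2 variables; the triangle inequality bounds each of them from below through al q - d q
    for a later client q, and only the running maximum of these differences is kept. The program
    then has three sequences, two of them monotone, and monotonicity survives averaging over blocks.
    For A1 the difficulty is that the order of the facilities by distance, the clusters and the
    split into close and distant shares are unrelated. Thinning turns every probability in question
    into one product over blocks, for which a one-line convexity argument holds whatever the
    overlap. *)

Definition invfact (R : realType) (k : nat) : R := (k`!%:R)^-1.

Lemma invfact0 (R : realType) : invfact R 0 = 1.
Proof. by rewrite /invfact fact0 invr1. Qed.

Lemma invfactS (R : realType) (k : nat) :
  invfact R k.+1 = invfact R k / k.+1%:R.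
Proof. by rewrite /invfact factS natrM invfM mulrC. Qed.

Lemma invfact_ge0 (R : realType) (k : nat) : 0 <= invfact R k.
Proof. by rewrite invr_ge0. Qed.

Lemma expR_ge_partial (R : realType) (x : R) (n : nat) :
  0 <= x -> \sum_(0 <= k < n) invfact R k * x ^+ k <= expR x.
Proof.
move=> x0; rewrite (eq_bigr (exp_coeff x)) => [|k _]; last first.
  by rewrite /exp_coeff /invfact /= mulrC.
apply: (@nondecreasing_cvgn_le R (series (exp_coeff x))).
  apply/nondecreasing_seqP => m; rewrite /series /= big_nat_recr //= lerDl.
  exact: exp_coeff_ge0.
exact: is_cvg_series_exp_coeff.
Qed.

(** Counting the last term twice absorbs the tail: 2/(m+2)! <= 1/(m+1)! makes these upper bounds
    nonincreasing in m. *)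
Lemma expR1_le_partial (R : realType) (n : nat) :
  expR 1 <= \sum_(0 <= k < n.+2) invfact R k + invfact R n.+1.
Proof.
pose s m : R := \sum_(0 <= k < m.+2) invfact R k.
have b m : s (n + m)%N + invfact R (n + m).+1 <= s n + invfact R n.+1.
  elim: m => [|m IH]; first by rewrite addn0.
  apply: le_trans IH; rewrite addnS /s big_nat_recr //= -addrA lerD2l invfactS.
  have : ((n + m).+2%:R)^-1 <= 2^-1 :> R.
    by rewrite lef_pV2 ?posrE ?ltr0n // (ler_nat R 2).
  have := invfact_ge0 R (n + m).+1.
  set a := invfact R _; set c := _^-1; nra.
rewrite /expR; apply: normed_module.limr_le; first exact: is_cvg_series_exp_coeff.
exists n.+2 => // m /= nm.
have [m' ->] : exists m', m = (n + m').+2.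
  by exists (m - n.+2)%N; rewrite -!addSn subnKC.
apply: le_trans (b m'); rewrite /series /= /s.
rewrite (eq_bigr (invfact R)) => [|k _]; last first.
  by rewrite /exp_coeff /invfact /= expr1n mul1r.
by rewrite lerDl invfact_ge0.
Qed.

Section Gamma0.
Variables (R : realType) (g : R).
Hypothesis gP : is_gamma0 g.
Let E : R := (expR 1)^-1.
Let u : R := expR (- g).

Lemma gamma0_eq : E + u = (g - 1) * (1 - E + u).
Proof. by case: gP => _ /eqP; rewrite subr_eq0 => /eqP. Qed.

(** The lower bound inverts 193/71, a continued-fraction convergent of e. *)
Lemma invr_expR1_bounds : 71 / 193 <= E <= 252 / 685.
Proof.
apply/andP; split.
  have := expR1_le_partial R 7.
  rewrite unlock /reducebig /= !invfactS invfact0 => h.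
  rewrite /E -[leRHS]div1r ler_pdivlMr ?expR_gt0 //; lra.
have := @expR_ge_partial R 1 9 ler01.
rewrite unlock /reducebig /= !invfactS invfact0 !expr1n => h.
rewrite /E -[leLHS]div1r ler_pdivrMr ?expR_gt0 //; lra.
Qed.

Lemma expRN_gamma0_gt0 : 0 < u. Proof. exact: expR_gt0. Qed.

Lemma gamma0_gt1 : 1 < g.
Proof.
have := gamma0_eq; have := expRN_gamma0_gt0.
have := invr_expR1_bounds => /andP[h1 h2] h3 h4.
rewrite ltNge; apply/negP => h5; nra.
Qed.

(** A larger root would force [u] below 37/198, which is too small to balance the equation. *)
Lemma gamma0_le : g <= 1409 / 840.
Proof.
rewrite leNgt; apply/negP => hg.
have hu : u <= 37 / 198.
  have h : u <= expR (- (1409 / 840)) by rewrite ler_expR lerN2 ltW.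
  apply: le_trans h _; rewrite expRN.
  have hx : 0 <= 1409 / 840 :> R by lra.
  have := expR_ge_partial 12 hx.
  rewrite unlock /reducebig /= !invfactS invfact0 => h.
  rewrite -[leLHS]div1r ler_pdivrMr ?expR_gt0 //; lra.
have := gamma0_eq; have := expRN_gamma0_gt0.
have := invr_expR1_bounds => /andP[h1 h2] h3 h4.
have : 0 < (g - 1409 / 840) * (1 - E + u) by rewrite mulr_gt0; lra.
lra.
Qed.

(** Solved for [u], the equation reads u (2 - g) = (g - 1)(1 - E) - E, so [u] grows with [g] and the
    upper bound on [g] suffices. *)
Lemma expRN_gamma0_le : u <= 43 / 230.
Proof.
have := gamma0_eq; have := expRN_gamma0_gt0.
have := invr_expR1_bounds => /andP[h1 h2] h3 h4.
have h5 := gamma0_gt1; have h6 := gamma0_le.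
rewrite leNgt; apply/negP => hu.
have : 0 < (u - 43 / 230) * (2 - g) by rewrite mulr_gt0; lra.
have : 0 <= (1409 / 840 - g) * (1 - E) by rewrite mulr_ge0; lra.
lra.
Qed.
End Gamma0.

(** * The factor-revealing linear program *)

(** Summation by parts: a nonnegative nonincreasing [b] is a nonnegative combination of indicators
    of prefixes. *)
Lemma abel_prefix_ge0 (R : numDomainType) (w b : nat -> R) (n : nat) :
    (forall m, (m <= n)%N -> 0 <= \sum_(i < m) w i) ->
    (forall i, (i < n)%N -> 0 <= b i) ->
    (forall i, (i.+1 < n)%N -> b i.+1 <= b i) ->
  0 <= \sum_(i < n) w i * b i.
Proof.
move=> hw hb hd; case: n hw hb hd => [|n] hw hb hd; first by rewrite big_ord0.
suff h m : (m <= n)%N ->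
    b m * (\sum_(i < m.+1) w i) <= \sum_(i < m.+1) w i * b i.
  by apply: le_trans (h n (leqnn n)); rewrite mulr_ge0 ?hw ?hb.
elim: m => [|m IH] hm; first by rewrite !big_ord1 mulrC.
rewrite big_ord_recr [leRHS]big_ord_recr /= mulrDr (mulrC (w m.+1)) lerD2r.
apply: le_trans (IH (ltnW hm)); rewrite ler_wpM2r ?hd //.
by rewrite hw // leqW.
Qed.

Lemma abel_suffix_ge0 (R : numDomainType) (w a : nat -> R) (n : nat) :
    (forall m, (m <= n)%N -> 0 <= \sum_(i < m) w (n - i.+1)%N) ->
    (forall i, (i < n)%N -> 0 <= a i) ->
    (forall i, (i.+1 < n)%N -> a i <= a i.+1) ->
  0 <= \sum_(i < n) w i * a i.
Proof.
move=> hw ha hd.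
rewrite (reindex_inj rev_ord_inj) /=.
apply: (abel_prefix_ge0 (w := fun i => w (n - i.+1)%N)
                        (b := fun i => a (n - i.+1)%N)) => //.
  by move=> i hi; apply: ha; lia.
move=> i hi; have -> : (n - i.+1)%N = (n - i.+2).+1 by lia.
by apply: hd; lia.
Qed.

(** Weak duality, with all multipliers scaled by [s]. Since [A] increases and [B] decreases, the
    column conditions of the dual need to hold only in cumulated form, from the right end for [A]
    and from the left end for [B]; this absorbs the multipliers of the monotonicity constraints. *)
Lemma certificate_bound (R : realFieldType) (N : nat) (A B D : nat -> R) (f : R)
    (t nu : nat -> R) (al be de : nat -> nat -> R) (s lf lc : R) :
    (forall I, (I < N)%N ->
       \sum_(J < N) (al I J * A J + be I J * B J - de I J * D J) <= t I * f) ->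
    (forall I, (I < N)%N ->
       [/\ 0 <= A I, 0 <= B I, 0 <= D I, A I - D I <= B I & 0 <= nu I]) ->
    (forall I, (I.+1 < N)%N -> A I <= A I.+1 /\ B I.+1 <= B I) ->
    (forall m, (m <= N)%N ->
       s *+ m <= \sum_(j < m) (\sum_(I < N) al I (N - j.+1)%N + nu (N - j.+1)%N)) ->
    (forall m, (m <= N)%N ->
       \sum_(j < m) nu j <= \sum_(j < m) \sum_(I < N) be I j) ->
    (forall j, (j < N)%N -> \sum_(I < N) de I j + nu j <= lc * s) ->
    \sum_(I < N) t I <= lf * s -> 0 <= f -> 0 < s ->
  \sum_(I < N) A I <= lf * f + lc * \sum_(I < N) D I.
Proof.
move=> fac sgn mono cA cB cD ct f0 s0.
have hA : 0 <= \sum_(j < N) (\sum_(I < N) al I j + nu j - s) * A j.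
  apply: (@abel_suffix_ge0 _ (fun j => \sum_(I < N) al I j + nu j - s)).
  - move=> m /cA h; rewrite sumrB subr_ge0 sumr_const card_ord.
    exact: h.
  - by move=> i /sgn [].
  - by move=> i /mono [].
have hB : 0 <= \sum_(j < N) (\sum_(I < N) be I j - nu j) * B j.
  apply: (@abel_prefix_ge0 _ (fun j => \sum_(I < N) be I j - nu j)).
  - by move=> m /cB h; rewrite sumrB subr_ge0.
  - by move=> i /sgn [].
  - by move=> i /mono [].
have hD : \sum_(j < N) (\sum_(I < N) de I j + nu j) * D j
            <= \sum_(j < N) lc * s * D j.
  apply: ler_sum => j _; have [_ _ d0 _ _] := sgn j (ltn_ord j).
  by rewrite ler_wpM2r // cD.
have hn : \sum_(j < N) nu j * (A j - D j - B j) <= 0.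
  apply: sumr_le0 => j _; have [_ _ _ h n0] := sgn j (ltn_ord j).
  by rewrite mulr_ge0_le0 // subr_le0.
have hf : \sum_(I < N) \sum_(J < N)
    (al I J * A J + be I J * B J - de I J * D J) <= lf * s * f.
  apply: (@le_trans _ _ ((\sum_(I < N) t I) * f)); last by rewrite ler_wpM2r.
  by rewrite mulr_suml; apply: ler_sum => I _; exact: fac.
have e : \sum_(I < N) \sum_(J < N) (al I J * A J + be I J * B J - de I J * D J)
   = \sum_(j < N) ((\sum_(I < N) al I j + nu j - s) * A j
       + (\sum_(I < N) be I j - nu j) * B j
       - (\sum_(I < N) de I j + nu j) * D j
       - nu j * (A j - D j - B j) + s * A j).
  rewrite exchange_big /=; apply: eq_bigr => j _.
  rewrite sumrB big_split /= -!mulr_suml; ring.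
move: hf; rewrite e big_split /= !sumrB big_split /= -mulr_sumr => hf.
have hD' : \sum_(j < N) lc * s * D j = lc * s * \sum_(j < N) D j.
  by rewrite mulr_sumr.
rewrite -(ler_pM2l s0).
have -> : s * (lf * f + lc * \sum_(I < N) D I)
        = lf * s * f + lc * s * \sum_(I < N) D I by ring.
rewrite -hD'; lra.
Qed.

(** * The dual certificate, in binary natural numbers so that [vm_compute] can check it *)

Definition sumN (n : nat) (g : nat -> N.t) : N.t :=
  foldr (fun i r => N.add (g i) r) 0%num (iota 0 n).

(* A dual solution of the block version of the factor-revealing LP with 50
   blocks, found numerically; A_I, B_I and D_I are the sums over block I of the
   sequences al, be and d of [fr_system], and multipliers are in units of 1/50000.
   [cert_t] weighs the facility inequalities and [cert_nu] the inequalities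
   A_I - D_I <= B_I; in the facility inequality of block I, the positive parts
   (B_I - 2 D_J)^+, J < I, are used with weight [cert_phi I J] and the positive
   parts (A_I - D_J)^+, I < J, with weight [cert_psi I J], while the diagonal
   block is estimated in two ways, with weights [cert_w1 I] and [cert_w2 I]. *)
Definition cert_t (I : nat) : N.t := nth 0%num
  ([:: 1265; 1298; 1333; 1369; 1408; 1449; 1492; 1538; 1586; 1638; 1699; 1437;
       1333; 1369; 1422] ++ nseq 19 1441 ++ [:: 697; 799; 926; 1085; 1283; 1660])%num I.

Definition cert_phi (I J : nat) : N.t := if (J < 34)%N then nth 0%num
  ([:: 0; 1282; 666; 684; 704; 724; 746; 769; 793; 819; 849; 718; 667; 685; 711;
       1226] ++ nseq 18 1441 ++ [:: 697; 799; 926; 1085; 1283; 1660])%num I else 0%num.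

Definition cert_psi (I J : nat) : N.t :=
  if (J < 40)%N || (11 < I)%N then cert_t I else if I == 11 then 909%num else 0%num.

Definition cert_w1 (I : nat) : N.t :=
  if I == 15 then 1011%num else if (15 < I < 35)%N then cert_t I else 0%num.

Definition cert_w2 (I : nat) : N.t :=
  if I == 0%N then 0%num else N.sub (cert_t I) (cert_w1 I).

Definition cert_nu (I : nat) : N.t :=
  if (I < 16)%N then 0%num
  else if (I < 34)%N then N.add 1012 (N.mul 1441 (N.of_nat (I - 16)))
  else nth 50000%num [:: 38456; 38354; 37428; 36343; 35060; 33400]%num (I - 34).

(* Coefficients of A_J, B_J and - D_J in four times the facility inequality of
   block I, weighted as above. *)
Definition comb_A (psi : nat -> N.t) (w1 w2 : N.t) (I J : nat) : N.t := N.add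
  (if J == I then N.mul 4
     (N.add (sumN 50 (fun J' => if (I < J')%N then psi J' else 0%num)) w1) else 0%num)
  (if J.+1 == I then N.mul 2 w2 else 0%num).

Definition comb_B (phi : nat -> N.t) (w2 : N.t) (I J : nat) : N.t := N.add
  (if J == I then N.mul 4
     (sumN 50 (fun J' => if (J' < I)%N then phi J' else 0%num)) else 0%num)
  (if J == I.+1 then w2 else 0%num).

Definition comb_D (phi psi : nat -> N.t) (w1 w2 : N.t) (I J : nat) : N.t := N.mul 4
  (N.add (if (J < I)%N then N.mul 2 (phi J) else 0%num)
  (N.add (if (I < J)%N then psi J else 0%num)
         (if J == I then N.add (N.mul 2 w1) w2 else 0%num))).

Definition cert_A (I : nat) : nat -> N.t :=
  comb_A (cert_psi I) (cert_w1 I) (cert_w2 I) I.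
Definition cert_B (I : nat) : nat -> N.t := comb_B (cert_phi I) (cert_w2 I) I.
Definition cert_D (I : nat) : nat -> N.t :=
  comb_D (cert_phi I) (cert_psi I) (cert_w1 I) (cert_w2 I) I.

Lemma cert_A_check : all (fun m =>
  N.leb (N.mul 200000 (N.of_nat m))
    (sumN m (fun j => N.add (sumN 50 (cert_A^~ (50 - j.+1)%N))
                            (N.mul 4 (cert_nu (50 - j.+1)%N))))) (iota 0 51).
Proof. by vm_compute. Qed.

Lemma cert_B_check : all (fun m =>
  N.leb (sumN m (fun j => N.mul 4 (cert_nu j)))
        (sumN m (fun j => sumN 50 (cert_B^~ j)))) (iota 0 51).
Proof. by vm_compute. Qed.

Lemma cert_D_check : all (fun j =>
  N.leb (N.add (sumN 50 (cert_D^~ j)) (N.mul 4 (cert_nu j))) 355464) (iota 0 50).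
Proof. by vm_compute. Qed.

Lemma cert_t_check : N.leb (N.mul 4 (sumN 50 cert_t)) 221862.
Proof. by vm_compute. Qed.

Lemma cert_bounds_check : all (fun I =>
  N.leb (N.add (cert_w1 I) (cert_w2 I)) (cert_t I) &&
  all (fun J => N.leb (cert_phi I J) (cert_t I) && N.leb (cert_psi I J) (cert_t I))
      (iota 0 50)) (iota 0 50).
Proof. by vm_compute. Qed.

Section CastN.
Variable R : realFieldType.
Definition rN (x : N.t) : R := (N.to_nat x)%:R.

Lemma rN_add x y : rN (N.add x y) = rN x + rN y.
Proof. by rewrite /rN N2Nat.inj_add natrD. Qed.

Lemma rN_mul x y : rN (N.mul x y) = rN x * rN y.
Proof. by rewrite /rN N2Nat.inj_mul natrM. Qed.

Lemma rN_ge0 x : 0 <= rN x. Proof. exact: ler0n. Qed.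

Lemma rN_le x y : N.leb x y -> rN x <= rN y.
Proof. by move=> h; rewrite /rN ler_nat; move/N.leb_le: h; lia. Qed.

Lemma rN_sum n g : rN (sumN n g) = \sum_(i < n) rN (g i).
Proof.
rewrite /sumN -(big_mkord xpredT (fun i => rN (g i))) /index_iota subn0.
elim: (iota 0 n) => [|i s IH] /=; first by rewrite big_nil.
by rewrite big_cons rN_add IH.
Qed.
End CastN.

(** A lower bound on what client [q] could offer when [p] is connected. If [q] is connected earlier,
    at cost r say, then any later client l has al l <= r + d q + d l, so r - d q is at least al l -
    d l - 2 d q, and the best such l gives [be p]. *)
Definition fr_term (R : realFieldType) (al d be : nat -> R) (p q : nat) : R :=
  if (q < p)%N then be p - 2 * d q else al p - d q.

(* Clients 0, ..., k-1 in the order in which JMS connects them, seen from one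
   facility with opening cost f: al are their budgets, d their distances to the
   facility, and be p bounds al q - d q for all q >= p. *)
Definition fr_system (R : realFieldType) (k : nat) (al d be : nat -> R) (f : R) :
    Prop :=
  [/\ forall p q, (p <= q < k)%N -> al p <= al q /\ be q <= be p,
      forall p, (p < k)%N ->
        [/\ 0 <= al p, 0 <= d p, 0 <= be p, al p - d p <= be p
          & be p - d p <= al p]
    & forall p, (p < k)%N ->
        \sum_(0 <= q < k) Num.max 0 (fr_term al d be p q) <= f].

(** * Replication of clients and averaging over blocks *)

Lemma sum_nat_blocks (V : nmodType) (n m : nat) (g : nat -> V) :
  \sum_(0 <= x < n * m) g x = \sum_(0 <= I < n) \sum_(0 <= v < m) g (I * m + v)%N.
Proof.
elim: n => [|n IH]; first by rewrite mul0n !big_geq.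
rewrite big_nat_recr //= -IH mulSn addnC (@big_cat_nat _ _ _ (n * m)%N) //=; last first.
  exact: leq_addr.
congr (_ + _); rewrite -{1}[(n * m)%N]add0n big_addn addKn.
by apply: eq_bigr => v _; rewrite addnC.
Qed.

Lemma fr_system_replicate (R : realFieldType) (k N : nat)
    (al d be : nat -> R) (f : R) :
    (0 < N)%N -> fr_system k al d be f ->
  fr_system (k * N) (fun x => al (x %/ N)%N) (fun x => d (x %/ N)%N)
    (fun x => be (x %/ N)%N) (N%:R * f).
Proof.
move=> N0 [mono sgn fac]; have lt x : (x < k * N)%N -> (x %/ N < k)%N.
  by rewrite ltn_divLR.
split.
- move=> p q /andP[pq qk]; apply: mono.
  by rewrite lt // leq_div2r.
- by move=> p pk; apply: sgn; exact: lt.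
move=> p pk; rewrite sum_nat_blocks.
apply: (@le_trans _ _ (\sum_(0 <= I < k) \sum_(0 <= v < N)
   Num.max 0 (fr_term al d be (p %/ N) I))).
  apply: ler_sum => I _; rewrite !big_mkord; apply: ler_sum => v _.
  rewrite /fr_term divnMDl // (divn_small (ltn_ord v)) addn0.
  have [_ d0 _ h h'] := sgn _ (lt _ pk).
  have := divn_eq p N; have := ltn_pmod p N0; have := ltn_ord v.
  set r := (p %% N)%N; set a := (p %/ N)%N => hv hr e.
  case: ltnP => h1; case: ltnP => h2.
  + by [].
  (* Copies of one client now precede each other, so the diagonal term al - d is replaced by be - 2
     d; this is where be p - d p <= al p is needed. *)
  + have aI : a = I by nia.
    by rewrite -aI; rewrite ge_max !le_max lexx /=; apply/orP; right;
      rewrite -/a in h'; lra.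
  + by exfalso; nia.
  + by [].
under eq_bigr do rewrite big_mkord sumr_const card_ord -[_ *+ N]mulr_natl.
rewrite -mulr_sumr ler_wpM2l //; exact: fac (lt _ pk).
Qed.

Section DiagonalBlock.
Variables (R : realFieldType) (m : nat) (a d b : nat -> R).
Hypothesis d_ge0 : forall u, (u < m)%N -> 0 <= d u.
Hypothesis ab : forall u, (u < m)%N -> a u - d u <= b u.
Hypothesis ba : forall u, (u < m)%N -> b u - d u <= a u.

Let G := \sum_(u < m) \sum_(v < m) Num.max 0 (fr_term a d b u v).

(** Below the diagonal b u is replaced by a u - d u. The extra cost d u, moved to the transposed
    entry, leaves at most 2 d v in every entry of column v. *)
Lemma diagonal_block1 : m%:R * (\sum_(u < m) a u - 2 * \sum_(u < m) d u) <= G.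
Proof.
pose e (u v : 'I_m) : R := if (v < u)%N then d u else 0.
pose h (u v : 'I_m) : R := if (v < u)%N then 2 * d v else d v.
have he : \sum_u \sum_v e u v = \sum_u \sum_v e v u by rewrite exchange_big.
have h1 : \sum_u \sum_v e u v + \sum_u \sum_v h u v
    <= m%:R * (2 * \sum_(v < m) d v).
  rewrite he -big_split /= mulr_sumr.
  apply: (@le_trans _ _ (\sum_(u < m) \sum_(v < m) 2 * d v)); last first.
    by rewrite sumr_const card_ord mulr_natl.
  apply: ler_sum => u _; rewrite -big_split /=; apply: ler_sum => v _.
  rewrite /e /h; have := d_ge0 (ltn_ord v); case: ltngtP; lra.
have h2 : \sum_(u < m) \sum_(v < m) (a u - (e u v + h u v)) <= G.
  apply: ler_sum => u _; apply: ler_sum => v _; rewrite le_max /fr_term /e /h.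
  have := ab (ltn_ord u); case: ltnP => _ h0; apply/orP; right; lra.
apply: le_trans h2; move: h1.
under [X in _ -> _ <= X]eq_bigr do
  rewrite sumrB sumr_const card_ord -[_ *+ m]mulr_natl big_split /=.
rewrite sumrB big_split /= -mulr_sumr; lra.
Qed.

(** Below the diagonal only half of the positive part of b u - 2 d v is used, so that every entry
    costs d v; a diagonal entry gets the average of both kinds. Transposed entries then add up to bn
    / 2 + ap everywhere. *)
Lemma diagonal_block2 (bn ap : R) :
    (forall u, (u < m)%N -> bn <= b u) -> (forall u, (u < m)%N -> ap <= a u) ->
  m%:R * (m%:R * bn / 4 + m%:R * ap / 2 - \sum_(u < m) d u) <= G.
Proof.
move=> hb ha.
pose e (u v : 'I_m) : R := if (v < u)%N then bn / 2 else
  if (u < v)%N then ap else ap / 2 + bn / 4.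
have he : \sum_u \sum_v e u v = \sum_u \sum_v e v u by rewrite exchange_big.
have h1 : \sum_u \sum_v e u v + \sum_u \sum_v e v u
    = \sum_(u < m) \sum_(v < m) (bn / 2 + ap).
  rewrite -big_split /=; apply: eq_bigr => u _; rewrite -big_split /=.
  by apply: eq_bigr => v _; rewrite /e; case: ltngtP => _; lra.
have h2 : \sum_(u < m) \sum_(v < m) (e u v - d v) <= G.
  apply: ler_sum => u _; apply: ler_sum => v _; rewrite /fr_term /e.
  have := d_ge0 (ltn_ord v); have := hb _ (ltn_ord u); have := ha _ (ltn_ord u).
  rewrite le_max; case: (ltngtP v u) => [h3|h3|/val_inj <-] h4 h5 h0.
  - case: (leP 0 (b u - 2 * d v)) => h6; apply/orP; [right|left]; lra.
  - case: (leP 0 (a u - d v)) => h6; apply/orP; [right|left]; lra.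
  - have := ba (ltn_ord v).
    case: (leP 0 (a v - d v)) => h6 h7; apply/orP; [right|left]; lra.
have hc x : \sum_(u < m) x = m%:R * x :> R.
  by rewrite sumr_const card_ord mulr_natl.
apply: le_trans h2; move: h1.
under [X in _ -> _ <= X]eq_bigr do rewrite sumrB.
rewrite sumrB -he !hc.
set s := \sum_u _; set D := \sum_(v < m) d v; set M := m%:R => h1.
have -> : s = M * (M * (bn / 2 + ap)) / 2 by lra.
by rewrite le_eqVlt; apply/orP; left; apply/eqP; field.
Qed.
End DiagonalBlock.

Definition block_sum (R : realFieldType) (m : nat) (g : nat -> R) (I : nat) : R :=
  \sum_(u < m) g (I * m + u)%N.

Lemma block_sum_ge0 (R : realFieldType) (n m : nat) (g : nat -> R) (I : nat) :
    (forall x, (x < n * m)%N -> 0 <= g x) -> (I < n)%N -> 0 <= block_sum m g I.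
Proof.
move=> h hI; apply: sumr_ge0 => u _; apply: h.
by have := ltn_ord u; nia.
Qed.

Section BlockFacility.
Variables (R : realFieldType) (n m : nat) (al d be : nat -> R) (f : R).
Hypothesis m_gt0 : (0 < m)%N.
Hypothesis sys : fr_system (n * m) al d be f.

Let A := block_sum m al.
Let B := block_sum m be.
Let D := block_sum m d.

Let idx_lt I u : (I < n)%N -> (u < m)%N -> (I * m + u < n * m)%N.
Proof. by move=> h1 h2; nia. Qed.

Lemma block_al_le I u : (I.+1 < n)%N -> (u < m)%N -> A I <= m%:R * al (I.+1 * m + u).
Proof.
move=> hI hu; have [mono _ _] := sys; rewrite mulr_natl.
rewrite -[X in _ *+ X](card_ord m) -sumr_const; apply: ler_sum => v _.
have := ltn_ord v => hv; have [] // := mono (I * m + v)%N (I.+1 * m + u)%N.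
by apply/andP; split; [nia|exact: idx_lt].
Qed.

Lemma block_be_le I u : (I.+1 < n)%N -> (u < m)%N -> B I.+1 <= m%:R * be (I * m + u).
Proof.
move=> hI hu; have [mono _ _] := sys; rewrite mulr_natl.
rewrite -[X in _ *+ X](card_ord m) -sumr_const; apply: ler_sum => v _.
have := ltn_ord v => hv; have [] // := mono (I * m + u)%N (I.+1 * m + v)%N.
by apply/andP; split; [nia|exact: idx_lt].
Qed.

Lemma block_mono I : (I.+1 < n)%N -> A I <= A I.+1 /\ B I.+1 <= B I.
Proof.
move=> hI; have [mono _ _] := sys.
split; apply: ler_sum => v _; have hv := ltn_ord v;
  by have [] // := mono (I * m + v)%N (I.+1 * m + v)%N;
     apply/andP; split; [nia|exact: idx_lt].
Qed.

Lemma block_sign I : (I < n)%N ->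
  [/\ 0 <= A I, 0 <= B I, 0 <= D I & A I - D I <= B I].
Proof.
move=> hI; have [_ sgn _] := sys.
split; try by apply: (@block_sum_ge0 _ n) => // x /sgn [].
rewrite -sumrB; apply: ler_sum => u _.
by have [] := sgn _ (idx_lt hI (ltn_ord u)).
Qed.

Let G I J := \sum_(u < m) \sum_(v < m)
  Num.max 0 (fr_term al d be (I * m + u)%N (J * m + v)%N).

Let G_ge0 I J : 0 <= G I J.
Proof.
by apply: sumr_ge0 => u _; apply: sumr_ge0 => v _; rewrite le_max lexx.
Qed.

Let sum_const (x : R) : \sum_(u < m) x = m%:R * x.
Proof. by rewrite sumr_const card_ord mulr_natl. Qed.

Let G_lower I J : (J < I)%N -> m%:R * (B I - 2 * D J) <= G I J.
Proof.
move=> h; apply: (@le_trans _ _ (\sum_(u < m) \sum_(v < m)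
    (be (I * m + u)%N - 2 * d (J * m + v)%N))).
  under eq_bigr do rewrite sumrB sum_const -mulr_sumr.
  by rewrite sumrB sum_const -mulr_sumr mulrBr.
apply: ler_sum => u _; apply: ler_sum => v _; rewrite le_max /fr_term.
have hu := ltn_ord u; have hv := ltn_ord v.
by rewrite ifT ?lexx ?orbT //; nia.
Qed.

Let G_upper I J : (I < J)%N -> m%:R * (A I - D J) <= G I J.
Proof.
move=> h; apply: (@le_trans _ _ (\sum_(u < m) \sum_(v < m)
    (al (I * m + u)%N - d (J * m + v)%N))).
  under eq_bigr do rewrite sumrB sum_const.
  by rewrite sumrB sum_const -mulr_sumr mulrBr.
apply: ler_sum => u _; apply: ler_sum => v _; rewrite le_max /fr_term.
have hu := ltn_ord u; have hv := ltn_ord v.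
by rewrite ifF ?lexx ?orbT //; apply/negbTE; rewrite -leqNgt; nia.
Qed.

(** Averages over the neighbouring blocks serve as the uniform lower bounds [bn] and [ap]. Beyond
    the ends 0 is a valid default, as [al] and [be] are nonnegative. *)
Definition block_diagonal I : R :=
  (if (I.+1 < n)%N then B I.+1 else 0) / 4 +
  (if (0 < I)%N then A I.-1 else 0) / 2 - D I.

Let G_diag I : (I < n)%N ->
  m%:R * (A I - 2 * D I) <= G I I /\ m%:R * block_diagonal I <= G I I.
Proof.
move=> hI; have [_ sgn _] := sys.
have s u : (u < m)%N -> _ := fun hu => sgn _ (idx_lt hI hu).
pose a u := al (I * m + u)%N; pose b u := be (I * m + u)%N.
pose d' u := d (I * m + u)%N.
have GE : G I I = \sum_(u < m) \sum_(v < m) Num.max 0 (fr_term a d' b u v).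
  apply: eq_bigr => u _; apply: eq_bigr => v _.
  by rewrite /fr_term ltn_add2l.
have m0 : 0 < m%:R :> R by rewrite ltr0n.
rewrite GE; split.
  by apply: diagonal_block1 => u /s [].
have := @diagonal_block2 R m a d' b _ _
  ((if (I.+1 < n)%N then B I.+1 else 0) / m%:R)
  ((if (0 < I)%N then A I.-1 else 0) / m%:R).
have e x y : m%:R * (x / m%:R) / y = x / y :> R.
  by rewrite mulrCA divff ?mulr1 // gt_eqF.
rewrite !e; apply.
- by move=> u /s [].
- by move=> u /s [].
- move=> u hu; rewrite ler_pdivrMr // mulrC; case: ifP => h.
    exact: block_be_le.
  by rewrite mulr_ge0 ?ler0n //; have [] := s _ hu.
move=> u hu; rewrite ler_pdivrMr // mulrC; case: ltnP => h.
  by have := @block_al_le I.-1 u; rewrite prednK //; apply.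
by rewrite mulr_ge0 ?ler0n //; have [] := s _ hu.
Qed.

Lemma block_facility I (T : R) (phi psi : nat -> R) (w1 w2 : R) :
    (I < n)%N -> (forall J, (J < n)%N -> 0 <= phi J <= T) ->
    (forall J, (J < n)%N -> 0 <= psi J <= T) ->
    0 <= w1 -> 0 <= w2 -> w1 + w2 <= T ->
  \sum_(J < n) ((if (J < I)%N then phi J else 0) * (B I - 2 * D J) +
                (if (I < J)%N then psi J else 0) * (A I - D J)) +
  w1 * (A I - 2 * D I) + w2 * block_diagonal I <= T * f.
Proof.
move=> hI hphi hpsi w10 w20 wT.
have m0 : 0 < m%:R :> R by rewrite ltr0n.
rewrite -(ler_pM2l m0); have [_ _ fac] := sys.
have T0 : 0 <= T by lra.
have hG : \sum_(J < n) G I J <= m%:R * f.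
  rewrite exchange_big /= -sum_const; apply: ler_sum => u _.
  apply: le_trans (fac _ (idx_lt hI (ltn_ord u))).
  rewrite sum_nat_blocks big_mkord; apply: ler_sum => J _.
  by rewrite big_mkord.
(* [T] times a positive part dominates any multiple with factor in [0, T] of the quantity inside;
   the two diagonal estimates share the factor [T]. *)
apply: (@le_trans _ _ (T * \sum_(J < n) G I J)); last first.
  by rewrite mulrCA ler_wpM2l.
rewrite [leRHS]mulr_sumr (bigD1 (Ordinal hI)) //= [leRHS](bigD1 (Ordinal hI)) //=.
rewrite ltnn !mul0r !add0r -addrA addrC mulrDr lerD //.
  have [h1 h2] := G_diag hI; have h3 := G_ge0 I I.
  rewrite mulrDr (mulrCA _ w1) (mulrCA _ w2).
  apply: (@le_trans _ _ (w1 * G I I + w2 * G I I)).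
    by rewrite lerD // ler_wpM2l.
  by rewrite -mulrDl ler_wpM2r.
rewrite mulr_sumr; apply: ler_sum => J /negP/negP hJ.
have /andP[p0 pT] := hphi J (ltn_ord J); have /andP[q0 qT] := hpsi J (ltn_ord J).
have hGJ := G_ge0 I J.
case: ltngtP => h.
- rewrite mul0r addr0 mulrCA; apply: (@le_trans _ _ (phi J * G I J)).
    by rewrite ler_wpM2l // G_lower.
  by rewrite ler_wpM2r.
- rewrite mul0r add0r mulrCA; apply: (@le_trans _ _ (psi J * G I J)).
    by rewrite ler_wpM2l // G_upper.
  by rewrite ler_wpM2r.
by case/eqP: hJ; apply: val_inj.
Qed.
End BlockFacility.

Lemma sum_delta (R : pzSemiRingType) (n k : nat) (e : R) (g : nat -> R) :
  \sum_(J < n) (if J == k :> nat then e else 0) * g J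
    = if (k < n)%N then e * g k else 0.
Proof.
case: ltnP => h.
  rewrite (bigD1 (Ordinal h)) //= eqxx big1 ?addr0 // => J hJ.
  rewrite ifF ?mul0r //; apply/negP => /eqP e'.
  by case/eqP: hJ; apply: val_inj.
rewrite big1 // => J _; rewrite ifF ?mul0r //.
by apply/negP => /eqP e'; have := ltn_ord J; rewrite e' ltnNge h.
Qed.

Section FactorRevealing.
Variable R : realFieldType.
Local Notation rN := (@rN R).

Lemma rN_if (b : bool) (x : N.t) :
  rN (if b then x else 0%num) = if b then rN x else 0.
Proof. by case: b. Qed.

Lemma rN_all (p q : nat -> N.t) (n : nat) :
  all (fun i => N.leb (p i) (q i)) (iota 0 n) ->
  forall i, (i < n)%N -> rN (p i) <= rN (q i).
Proof. by move=> /allP h i hi; apply/rN_le/h; rewrite mem_iota. Qed.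

(** Collects coefficients; the factor 4 clears the denominators of the diagonal estimate, so that
    they are natural numbers. *)
Lemma comb_facility (phi psi : nat -> N.t) (w1 w2 t : N.t)
    (A B D : nat -> R) (f : R) (I : nat) :
    (I < 50)%N ->
    \sum_(J < 50) ((if (J < I)%N then rN (phi J) else 0) * (B I - 2 * D J) +
                   (if (I < J)%N then rN (psi J) else 0) * (A I - D J)) +
    rN w1 * (A I - 2 * D I) +
    rN w2 * ((if (I.+1 < 50)%N then B I.+1 else 0) / 4 +
                      (if (0 < I)%N then A I.-1 else 0) / 2 - D I)
      <= rN t * f ->
  \sum_(J < 50) (rN (comb_A psi w1 w2 I J) * A J + rN (comb_B phi w2 I J) * B J
                 - rN (comb_D phi psi w1 w2 I J) * D J) <= 4 * rN t * f.
Proof.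
move=> hI h.
have hd J e (g : nat -> R) : (J < 50)%N ->
    \sum_(i < 50) (if i == J :> nat then e else 0) * g i = e * g J.
  by move=> hJ; rewrite sum_delta hJ.
have eA : \sum_(J < 50) rN (comb_A psi w1 w2 I J) * A J
   = 4 * (\sum_(J < 50) (if (I < J)%N then rN (psi J) else 0)
          + rN w1) * A I
     + 2 * rN w2 * (if (0 < I)%N then A I.-1 else 0).
  under eq_bigr do rewrite rN_add !rN_if !rN_mul mulrDl.
  rewrite big_split /= sum_delta hI; congr (_ + _).
    by rewrite rN_add rN_sum; under [in LHS]eq_bigr do rewrite rN_if.
  case: I hI {h} => [|I] hI.
    rewrite ltnn [RHS]mulr0 big1 // => J _.
    by rewrite /= mul0r.
  under eq_bigr do rewrite eqSS.
  by rewrite sum_delta ltnW.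
have eB : \sum_(J < 50) rN (comb_B phi w2 I J) * B J
   = 4 * (\sum_(J < 50) (if (J < I)%N then rN (phi J) else 0)) * B I
     + rN w2 * (if (I.+1 < 50)%N then B I.+1 else 0).
  under eq_bigr do rewrite rN_add !rN_if !rN_mul mulrDl.
  rewrite big_split /= !sum_delta hI; congr (_ + _).
    rewrite rN_sum; congr (_ * _ * _).
    by apply: eq_bigr => J _; rewrite rN_if.
  by case: ifP => //; rewrite mulr0.
have eD : \sum_(J < 50) rN (comb_D phi psi w1 w2 I J) * D J
   = 4 * (\sum_(J < 50) (2 * (if (J < I)%N then rN (phi J) else 0) * D J
          + (if (I < J)%N then rN (psi J) else 0) * D J)
          + (2 * rN w1 + rN w2) * D I).
  have r2 : rN 2 = 2 by [].
  have r4 : rN 4 = 4 by [].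
  rewrite -(hd I (2 * rN w1 + rN w2) D) // -big_split /= mulr_sumr.
  apply: eq_bigr => J _.
  rewrite rN_mul !rN_add !rN_if rN_add !rN_mul r2 r4.
  by do 3 case: ifP => _; ring.
rewrite sumrB big_split /= eA eB eD.
apply: (@le_trans _ _ (4 * (rN t * f))); last by rewrite mulrA.
apply: le_trans (ler_wpM2l (ler0n R 4) h).
rewrite le_eqVlt; apply/orP; left; apply/eqP.
rewrite !big_split /=.
under [X in _ = 4 * (X + _ + _ + _)]eq_bigr do rewrite mulrBr.
under [X in _ = 4 * (_ + X + _ + _)]eq_bigr do rewrite mulrBr.
rewrite !sumrB -!mulr_suml.
under [X in _ = 4 * (_ - X + _ + _ + _)]eq_bigr do rewrite mulrCA mulrA.
by field.
Qed.

Lemma fr_bound (k : nat) (al d be : nat -> R) (f : R) :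
    (0 < k)%N -> fr_system k al d be f ->
  \sum_(0 <= p < k) al p
    <= 274 / 247 * f + 439 / 247 * \sum_(0 <= p < k) d p.
Proof.
move=> k0 sys; have sys' := fr_system_replicate (isT : (0 < 50)%N) sys.
(* k groups of 50 copies are the same list as 50 blocks of k, so the number of blocks does not
   depend on k. *)
rewrite mulnC in sys'.
have f0 : 0 <= f.
  by have [_ _ /(_ 0%N k0)] := sys; apply: le_trans; apply: sumr_ge0 => q _;
     rewrite le_max lexx.
have rep (g : nat -> R) :
    \sum_(I < 50) block_sum k (fun x => g (x %/ 50)%N) I
      = 50 * \sum_(0 <= p < k) g p.
  rewrite -(big_mkord xpredT (fun I => block_sum k (fun x => g (x %/ 50)%N) I)).
  under eq_bigr do rewrite /block_sum -(big_mkord xpredT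
    (fun u => g ((_ * k + u) %/ 50)%N)).
  rewrite -(sum_nat_blocks 50 k (fun x => g (x %/ 50)%N)) mulnC sum_nat_blocks.
  rewrite mulr_sumr; apply: eq_bigr => p _; rewrite big_mkord.
  under eq_bigr => v _ do rewrite divnMDl // (divn_small (ltn_ord v)) addn0.
  by rewrite sumr_const card_ord mulr_natl.
(* The scale 4 * 50000 stays behind a variable, so that the numeral is not unfolded into a unary
   number. *)
have [S eS] : exists S, S = rN 200000 by exists (rN 200000).
have S0 : 0 < S by rewrite eS ltr0n; lia.
have := @certificate_bound R 50 (block_sum k (fun x => al (x %/ 50)%N))
  (block_sum k (fun x => be (x %/ 50)%N)) (block_sum k (fun x => d (x %/ 50)%N))
  (50 * f) (fun I => 4 * rN (cert_t I)) (fun I => 4 * rN (cert_nu I))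
  (fun I J => rN (cert_A I J)) (fun I J => rN (cert_B I J))
  (fun I J => rN (cert_D I J)) S (274 / 247) (439 / 247).
rewrite !rep => H.
suff : 50 * \sum_(0 <= p < k) al p
    <= 274 / 247 * (50 * f) + 439 / 247 * (50 * \sum_(0 <= p < k) d p) by lra.
have r4 : rN 4 = 4 by [].
have bnd I : (I < 50)%N -> [/\ rN (cert_w1 I) + rN (cert_w2 I) <= rN (cert_t I),
    forall J, (J < 50)%N -> rN (cert_phi I J) <= rN (cert_t I)
  & forall J, (J < 50)%N -> rN (cert_psi I J) <= rN (cert_t I)].
  move=> hI; have /allP /(_ I) := cert_bounds_check.
  rewrite mem_iota => /(_ hI) /andP[h1 /allP h2].
  split; first by rewrite -rN_add rN_le.
    by move=> J hJ; apply: rN_le; have := h2 J; rewrite mem_iota => /(_ hJ)/andP[].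
  by move=> J hJ; apply: rN_le; have := h2 J; rewrite mem_iota => /(_ hJ)/andP[].
apply: H.
- move=> I hI; have [h1 h2 h3] := bnd I hI.
  apply: comb_facility => //.
  apply: (@block_facility _ _ _ _ _ _ _ k0 sys' I (rN (cert_t I))
    (fun J => rN (cert_phi I J)) (fun J => rN (cert_psi I J))
    (rN (cert_w1 I)) (rN (cert_w2 I)) hI _ _ _ _ h1).
  + by move=> J hJ; rewrite rN_ge0 h2.
  + by move=> J hJ; rewrite rN_ge0 h3.
  + exact: rN_ge0.
  + exact: rN_ge0.
- move=> I hI; have [? ? ? ?] := block_sign k0 sys' hI.
  by split=> //; rewrite mulr_ge0 ?rN_ge0.
- by move=> I hI; apply: block_mono k0 sys' _ hI.
- move=> m hm; have := @rN_all _ _ _ cert_A_check m hm.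
  rewrite rN_mul rN_sum -eS.
  under [X in _ <= X -> _]eq_bigr do rewrite rN_add rN_sum rN_mul r4.
  by rewrite {1}/rN Nat2N.id mulr_natr.
- move=> m hm; have := @rN_all _ _ _ cert_B_check m hm.
  rewrite !rN_sum.
  under eq_bigr do rewrite rN_mul r4.
  by under [X in _ <= X -> _]eq_bigr do rewrite rN_sum.
- move=> j hj; have := @rN_all _ _ _ cert_D_check j hj.
  rewrite rN_add rN_sum rN_mul r4 => /le_trans; apply.
  have h : rN (N.mul 247 355464) <= rN (N.mul 439 200000) by exact: rN_le.
  move: h; rewrite !rN_mul -eS.
  have -> : rN 247 = 247 by [].
  have -> : rN 439 = 439 by [].
  by move: (rN 355464) => X; lra.
- have h : rN (N.mul 4 (sumN 50 cert_t)) <= rN 221862.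
    by apply: rN_le; exact: cert_t_check.
  rewrite rN_mul rN_sum r4 in h.
  rewrite -mulr_sumr; refine (le_trans h _).
  have {h} : rN (N.mul 247 221862) <= rN (N.mul 274 200000) by exact: rN_le.
  rewrite !rN_mul -eS.
  have -> : rN 247 = 247 by [].
  have -> : rN 274 = 274 by [].
  by move: (rN 221862) => X; lra.
- by rewrite mulr_ge0.
- exact: S0.
Qed.
End FactorRevealing.

(** * The JMS algorithm *)

Section JMS.
Variables (R : realType) (F C : finType) (f : F -> R) (c : F -> C -> R).
Hypotheses (f_ge0 : forall i, 0 <= f i) (c_ge0 : forall i j, 0 <= c i j).
Hypothesis c_metric : ufl_metric c.

Definition jms_cur (st : jms_state R F C) (j : C) : R :=
  if jms_link st j is Some i then c i j else jms_budget st j.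

Lemma jms_offerE st i j :
  jms_offer c st i j = Num.max 0 (jms_cur st j - c i j).
Proof. by rewrite /jms_offer /jms_cur; case: jms_link. Qed.

(* [rk l] is the rank of the event that connects l; clients connected by the same
   event have the same rank.  [cur l k] is what k could spend just before that
   event: its connection cost, or its budget if it is not connected yet. *)
Definition jms_history (u : C -> R) (rk : C -> nat) (cur : C -> C -> R) : Prop :=
  [/\ forall l m, (rk l <= rk m)%N -> u l <= u m,
      forall l m j, (rk l <= rk m)%N -> (rk j < rk l)%N -> cur m j <= cur l j,
      forall l i, \sum_j Num.max 0 (cur l j - c i j) <= f i,
      forall l j i, (rk j < rk l)%N -> u l <= cur l j + c i j + c i l
    & (forall l j, (rk l <= rk j)%N -> cur l j = u l) /\
      (forall l j, cur l j <= u j)].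

(** In [inv_hist], [t] is the current time and [n] the rank shared by all unconnected clients. Their
    snapshots follow the current state and freeze on connection. [inv_cost] says that opened
    facilities are paid by what the clients saved on their budgets. *)
Record jms_inv (st : jms_state R F C) : Prop := JmsInv {
  inv_ge0 : forall j, 0 <= jms_budget st j;
  inv_offers : forall i, \sum_j Num.max 0 (jms_cur st j - c i j) <= f i;
  inv_open : forall i j, i \in jms_open st -> jms_cur st j <= c i j;
  inv_link : forall i j, jms_link st j = Some i -> i \in jms_open st;
  inv_cost : \sum_(i in jms_open st) f i
               <= \sum_j (jms_budget st j - jms_cur st j);
  inv_hist : exists t n rk cur,
    [/\ jms_history (jms_budget st) rk cur,
        forall j, jms_budget st j <= t,
        forall j, jms_link st j = None ->
          [/\ jms_budget st j = t, rk j = n & cur j = jms_cur st]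
      & forall j, jms_link st j <> None -> (rk j < n)%N]
}.

Lemma jms_inv_init : jms_inv (jms_init R F C).
Proof.
have off i : \sum_j Num.max 0 (jms_cur (jms_init R F C) j - c i j) <= f i.
  by rewrite big1 // => j _; rewrite /jms_cur /= max_l // sub0r oppr_le0.
split=> //.
- by rewrite /= big_set0 sumr_ge0 // => j _; rewrite /jms_cur /= subrr.
by exists 0, 0%N, (fun=> 0%N), (fun=> jms_cur (jms_init R F C)).
Qed.

Lemma jms_history_rank (st : jms_state R F C) n rk :
    (forall j, jms_link st j = None -> rk j = n) ->
    (forall j, jms_link st j <> None -> (rk j < n)%N) ->
  forall j, (rk j <= n)%N.
Proof.
move=> h1 h2 j; case e: (jms_link st j) => [i|].
  by apply/ltnW/h2; rewrite e.
by rewrite h1.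
Qed.

(** The facility serving [j] is open, so it is still no closer to [l] than the budget of [l]; a
    detour through [j] and [i] bounds that distance. *)
Lemma jms_unlinked_le (st : jms_state R F C) :
    (forall i j, i \in jms_open st -> jms_cur st j <= c i j) ->
    (forall i j, jms_link st j = Some i -> i \in jms_open st) ->
  forall l j i, jms_link st l = None -> jms_link st j <> None ->
    jms_budget st l <= jms_cur st j + c i j + c i l.
Proof.
move=> hopen hlink l j i lN; case e: (jms_link st j) => [i'|] // _.
have := hopen _ l (hlink _ _ e); rewrite {1}/jms_cur lN => h.
apply: le_trans h _; rewrite /jms_cur e.
exact: c_metric.
Qed.

Lemma jms_inv_event (st st' : jms_state R F C) :
    jms_inv st -> jms_budget st' = jms_budget st ->
    (forall j, jms_link st' j = None -> jms_link st j = None) ->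
    (forall j, jms_cur st' j <= jms_cur st j) ->
    (forall i j, i \in jms_open st' -> jms_cur st' j <= c i j) ->
    (forall i j, jms_link st' j = Some i -> i \in jms_open st') ->
    \sum_(i in jms_open st') f i
      <= \sum_j (jms_budget st' j - jms_cur st' j) ->
  jms_inv st'.
Proof.
move=> [hge0 hoff _ _ _ [t [n [rk [cur [[P0 P1 P2 P3 [P4 P5]] ht hN hS]]]]]].
move=> eb hl hc hopen' hlink' hcost'.
have off' i : \sum_j Num.max 0 (jms_cur st' j - c i j) <= f i.
  apply: le_trans (hoff i); apply: ler_sum => j _.
  by rewrite ge_max le_max lexx /= le_max lerB ?orbT.
split=> //; first by rewrite eb.
have rkn := jms_history_rank (fun j h => let: And3 _ e _ := hN j h in e) hS.
(* Clients connected by this event keep rank [n] and the snapshot taken before it; those still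
   waiting move on to rank n + 1. *)
pose rk' j := if jms_link st' j is None then n.+1 else rk j.
pose cur' l := if jms_link st' l is None then jms_cur st' else cur l.
have rkN j : jms_link st' j = None -> rk' j = n.+1 by rewrite /rk' => ->.
have rkS j : jms_link st' j <> None -> rk' j = rk j.
  by rewrite /rk'; case: (jms_link st' j).
have curN j : jms_link st' j = None -> cur' j = jms_cur st'.
  by rewrite /cur' => ->.
have curS j : jms_link st' j <> None -> cur' j = cur j.
  by rewrite /cur'; case: (jms_link st' j).
have dec j : jms_link st' j = None \/ jms_link st' j <> None.
  by case: (jms_link st' j) => [?|]; [right|left].
have ltS j m : (rk' j < rk' m)%N -> jms_link st' j <> None.
  move=> h e; move: h; rewrite (rkN _ e); case: (dec m) => hm.
    by rewrite (rkN _ hm) ltnn.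
  by rewrite (rkS _ hm) ltnNge (leq_trans (rkn m)).
have leS l m : (rk' l <= rk' m)%N -> jms_link st' m <> None ->
    jms_link st' l <> None.
  move=> h hm e; move: h; rewrite (rkN _ e) (rkS _ hm) leqNgt ltnS.
  by rewrite (rkn m).
exists t, n.+1, rk', cur'; rewrite eb; split.
- split.
  + move=> l m h; case: (dec m) => hm.
      by have [-> _ _] := hN _ (hl _ hm).
    have hl' := leS _ _ h hm; apply: P0; by rewrite -(rkS _ hl') -(rkS _ hm).
  + move=> l m j h hj; have j' := ltS _ _ hj; case: (dec l) => hl'.
      case: (dec m) => hm; first by rewrite !curN.
      by case: (leS _ _ h hm).
    move: hj; rewrite (rkS _ j') (rkS _ hl') (curS _ hl') => hj.
    case: (dec m) => hm.
      rewrite curN //; apply: le_trans (hc j) _.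
      have [_ em <-] := hN _ (hl _ hm); apply: P1 => //.
      by rewrite em rkn.
    rewrite (curS _ hm); apply: P1 => //.
    by move: h; rewrite (rkS _ hl') (rkS _ hm).
  + move=> l i; case: (dec l) => hl'; first by rewrite curN.
    by rewrite curS.
  + move=> l j i h; have hj := ltS _ _ h; case: (dec l) => hl'.
      by rewrite curN // -eb; exact: jms_unlinked_le.
    by rewrite curS //; apply: P3; move: h; rewrite !rkS.
  + split=> l j.
      case: (dec l) => hl'; case: (dec j) => hj.
      - move=> _; rewrite curN // /jms_cur hj eb.
        by have [-> _ _] := hN _ (hl _ hj); have [-> _ _] := hN _ (hl _ hl').
      - move=> h; by case: (leS _ _ h hj).
      - move=> _; rewrite curS //; apply: P4.
        by have [_ -> _] := hN _ (hl _ hj); exact: rkn.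
      - by rewrite !rkS // curS //; exact: P4.
    case: (dec l) => hl'; last by rewrite curS.
    rewrite curN //; apply: le_trans (hc j) _.
    by have [_ _ <-] := hN _ (hl _ hl').
- by [].
- by move=> j hj; rewrite rkN // curN //; have [-> _ _] := hN _ (hl _ hj).
- by move=> j hj; rewrite rkS // ltnS.
Qed.
Lemma jms_cur_grow (st : jms_state R F C) d j :
  jms_cur (jms_grow st d) j =
    jms_cur st j + (if jms_link st j is None then d else 0).
Proof. by rewrite /jms_cur /=; case: (jms_link st j) => [?|] //=; rewrite addr0. Qed.

Lemma jms_inv_grow (st : jms_state R F C) d :
    jms_inv st -> 0 < d ->
    (forall e, 0 <= e < d ->
       (forall i, ~~ jms_can_open f c (jms_grow st e) i) /\
       (forall i j, ~~ jms_can_connect c (jms_grow st e) i j)) ->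
  jms_inv (jms_grow st d).
Proof.
move=> [hge0 hoff hopen hlink hcost].
move=> [t [n [rk [cur [[P0 P1 P2 P3 [P4 P5]] ht hN hS]]]]].
move=> d0 hd.
have open' i j : i \in jms_open (jms_grow st d) ->
    jms_cur (jms_grow st d) j <= c i j.
  move=> /= hi; rewrite jms_cur_grow.
  case e: (jms_link st j) => [i'|]; first by rewrite addr0 hopen.
  rewrite leNgt; apply/negP => hlt; rewrite /jms_cur e in hlt.
  have hb := hopen i j hi; rewrite /jms_cur e in hb.
  (* The moment at which the budget of [j] reaches [i]; were it before the end of the step, a
     connection would have been enabled then. *)
  have [|_ /(_ i j)] := hd (c i j - jms_budget st j); first by apply/andP; lra.
  rewrite /jms_can_connect /= hi e /=; lra.
have off' i : \sum_j Num.max 0 (jms_cur (jms_grow st d) j - c i j) <= f i.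
  case hi: (i \in jms_open st).
    rewrite big1 // => j _; rewrite max_l // subr_le0.
    exact: open'.
  rewrite leNgt; apply/negP => hlt.
  set s := \sum_j _ in hlt.
  (* The total offer grows at rate at most #|C|. Going back by the excess divided by #|C| + 1, or to
     the start of the step, still leaves it above [f i], so [i] could have been opened earlier. *)
  pose k : R := #|C|%:R + 1.
  have k0 : 0 < k by rewrite ltr_wpDl.
  pose e := Num.max 0 (d - (s - f i) / k).
  have he : 0 <= e < d.
    by rewrite /e le_max lexx /= gt_max d0 /= gtrBl divr_gt0 // subr_gt0.
  have [/(_ i)] := hd e he.
  rewrite /jms_can_open /= hi /= -ltNge => hs _.
  suff : s <= \sum_j jms_offer c (jms_grow st e) i j + (d - e) * #|C|%:R.
    have : (d - e) * k <= s - f i.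
      rewrite -ler_pdivlMr // lerBlDl -lerBlDr.
      by rewrite /e le_max lexx orbT.
    have : 0 < d - e by lra.
    rewrite /k; nra.
  rewrite -[#|C|]sum1_card natr_sum mulr_sumr -big_split /=.
  apply: ler_sum => j _; rewrite jms_offerE !jms_cur_grow.
  rewrite ge_max; apply/andP; split.
    rewrite addr_ge0 ?le_max ?lexx //; nra.
  apply: (@le_trans _ _ (jms_cur st j + (if jms_link st j is None then e else 0)
     - c i j + (d - e) * 1)).
    by case: jms_link => [?|]; lra.
  by rewrite lerD2r le_max lexx orbT.
have dec j : jms_link st j = None \/ jms_link st j <> None.
  by case: (jms_link st j) => [?|]; [right|left].
have rkn := jms_history_rank (fun j h => let: And3 _ e _ := hN j h in e) hS.
pose cur' l := if jms_link st l is None then jms_cur (jms_grow st d) else cur l.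
have curN j : jms_link st j = None -> cur' j = jms_cur (jms_grow st d).
  by rewrite /cur' => ->.
have curS j : jms_link st j <> None -> cur' j = cur j.
  by rewrite /cur'; case: (jms_link st j).
have ltS j m : (rk j < rk m)%N -> jms_link st j <> None.
  by move=> h e; have [_ er _] := hN _ e; rewrite er ltnNge rkn in h.
have leS l m : (rk l <= rk m)%N -> jms_link st m <> None ->
    jms_link st l <> None.
  move=> h hm e; have [_ er _] := hN _ e.
  by move: h; rewrite er leqNgt hS.
have bN j : jms_link st j = None -> jms_budget (jms_grow st d) j = t + d.
  by move=> e; have [<- _ _] := hN _ e; rewrite /= e.
have bS j : jms_link st j <> None ->
    jms_budget (jms_grow st d) j = jms_budget st j.
  by rewrite /=; case: (jms_link st j).
have bt j : jms_budget (jms_grow st d) j <= t + d.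
  case: (dec j) => hj; first by rewrite bN.
  by rewrite bS //; have := ht j; lra.
have cS j : jms_link st j <> None ->
    jms_cur (jms_grow st d) j = jms_cur st j.
  by rewrite jms_cur_grow; case: (jms_link st j) => [?|] //=; rewrite addr0.
split=> //.
- move=> j /=; have := hge0 j; case: jms_link => [?|]; lra.
- apply: le_trans hcost _; apply: ler_sum => j _.
  by rewrite jms_cur_grow /=; case: (jms_link st j) => [?|]; lra.
exists (t + d), n, rk, cur'; split.
- split.
  + move=> l m h; case: (dec m) => hm; first by rewrite (bN m).
    by rewrite !bS //; [apply: P0|exact: leS hm].
  + move=> l m j h hj; have j' := ltS _ _ hj; case: (dec l) => hl'.
      case: (dec m) => hm; first by rewrite !curN.
      by case: (leS _ _ h hm).
    rewrite (curS _ hl'); case: (dec m) => hm; last by rewrite curS //; apply: P1.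
    by rewrite curN // cS //; have [_ _ <-] := hN _ hm; apply: P1.
  + move=> l i; case: (dec l) => hl'; first by rewrite curN.
    by rewrite curS.
  + move=> l j i h; have hj := ltS _ _ h; case: (dec l) => hl'.
      by rewrite curN //; exact: jms_unlinked_le.
    by rewrite curS // bS //; apply: P3.
  + split=> l j.
      move=> h; case: (dec l) => hl'.
        have hj : jms_link st j = None.
          case: (dec j) => // hj.
          by case: (leS _ _ h hj).
        by rewrite curN // bN // -(bN j) // /jms_cur /= hj.
      by rewrite curS // bS //; apply: P4.
    case: (dec l) => hl'.
      have [_ _ hc] := hN _ hl'; have := P5 l j; rewrite hc curN // jms_cur_grow /=.
      by case: (jms_link st j) => [?|]; lra.
    rewrite curS //; apply: le_trans (P5 l j) _ => /=.
    by case: (jms_link st j) => // ; lra.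
- by [].
- by move=> j hj; rewrite bN // curN //; have [_ -> _] := hN _ hj.
- by [].
Qed.

Lemma jms_cur_open (st : jms_state R F C) i j :
  jms_cur (jms_do_open c st i) j = Num.min (jms_cur st j) (c i j).
Proof.
rewrite /jms_cur /= /jms_offer minC minEle.
case: (jms_link st j) => [i'|] /=; rewrite ?orbF lt_max ltxx /= subr_gt0.
  by rewrite le_eqVlt; case: ltP => //; case: eqP => // ->.
by case: ltgtP.
Qed.

Lemma jms_inv_step (st st' : jms_state R F C) :
  jms_inv st -> jms_step f c st st' -> jms_inv st'.
Proof.
move=> hst; case=> {st'} [i /andP[hi hf]|i j /and3P[hi /eqP lj cj]|d d0 hd];
  last exact: jms_inv_grow.
  have [_ hoff hopen hlink hcost _] := hst.
  apply: (jms_inv_event hst) => //.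
  - by move=> j /=; case: ifP.
  - by move=> j; rewrite jms_cur_open ge_min lexx.
  - move=> i' j /=; rewrite !inE jms_cur_open ge_min => /orP[/eqP ->|h].
      by rewrite lexx orbT.
    by rewrite hopen.
  - move=> i' j /=; rewrite !inE; case: ifP => [_ [->]|_ /hlink ->];
      by rewrite ?eqxx ?orbT.
  - rewrite /= big_setU1 //=.
    (* The offers to [i] are exactly what the clients save by its opening, and they cover [f i]. *)
    rewrite (eq_bigr (fun j => jms_budget st j - jms_cur st j +
                               jms_offer c st i j)) => [|j _].
      by rewrite big_split /= addrC lerD.
    rewrite jms_cur_open jms_offerE; case: (leP (jms_cur st j) (c i j)) => h.
      by rewrite max_l ?addr0 // subr_le0.
    by rewrite max_r ?subr_ge0 ?ltW //; ring.
have [_ hoff hopen hlink hcost _] := hst.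
(* No open facility is closer than the budget, so at the moment of connection distance and budget
   coincide. *)
have curE k : jms_cur (jms_do_connect st i j) k = jms_cur st k.
  rewrite /jms_cur /=; case: eqP => // ->; rewrite lj.
  by apply/eqP; rewrite eq_le cj /=; have := hopen i j hi; rewrite /jms_cur lj.
apply: (jms_inv_event hst) => //.
- by move=> k /=; case: ifP.
- by move=> k; rewrite curE.
- by move=> i' k; rewrite curE => /hopen.
- by move=> i' k /=; case: ifP => [_ [<-]|_ /hlink].
- by under [leRHS]eq_bigr do rewrite curE.
Qed.

Lemma jms_reachable_inv (st : jms_state R F C) :
  jms_reachable f c st -> jms_inv st.
Proof.
by elim=> [|st1 st2 _ h _]; [exact: jms_inv_init|exact: jms_inv_step].
Qed.

Lemma jms_run_history (S : {set F}) (a : C -> F) :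
    jms_run f c S a ->
  exists u rk cur, [/\ jms_history u rk cur, forall j, 0 <= u j
    & solution_cost f c S a <= \sum_j u j].
Proof.
move=> [st [/jms_reachable_inv [h0 _ _ _ hcost [t [n [rk [cur [h _ _ _]]]]]] <- hl]].
exists (jms_budget st), rk, cur; split=> //.
rewrite /solution_cost -lerBrDr -sumrB; apply: le_trans hcost _.
by apply: ler_sum => j _; rewrite /jms_cur hl.
Qed.

(** * From JMS histories to the bifactor bound *)

Lemma jms_history_fr_system u rk cur (i : F) (s : seq C) (j0 : C) :
    jms_history u rk cur -> (forall j, 0 <= u j) ->
    sorted (relpre rk leq) s -> uniq s ->
  exists be, fr_system (size s) (fun p => u (nth j0 s p))
    (fun p => c i (nth j0 s p)) be (f i).
Proof.
move=> [P0 P1 P2 P3 [P4 P5]] u0 srt us.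
pose al p := u (nth j0 s p); pose d p := c i (nth j0 s p); set k := size s.
pose be p := \big[Num.max/0]_(q < k | (p <= q)%N) (al q - d q).
have rks p q : (p <= q < k)%N -> (rk (nth j0 s p) <= rk (nth j0 s q))%N.
  move=> /andP[pq qk].
  have tr : transitive (relpre rk leq) by move=> x y z /=; apply: leq_trans.
  have rf : reflexive (relpre rk leq) by move=> x /=.
  by apply: (sorted_leq_nth tr rf j0 srt) => //; rewrite inE // (leq_ltn_trans pq).
have be_ge p q : (p <= q < k)%N -> al q - d q <= be p.
  move=> /andP[pq qk].
  exact: (@le_bigmax_cond _ _ _ _ (Ordinal qk) (fun q : 'I_k => (p <= q)%N)).
(* This yields be p - d p <= al p: a client connected later than [p] is limited by the detour
   through [p], and for equal ranks the budgets agree. *)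
have late p m : (rk p <= rk m)%N -> u m <= u p + c i p + c i m.
  move=> _; case: (ltnP (rk p) (rk m)) => h.
    apply: le_trans (P3 m p i h) _; by rewrite !lerD2r.
  by apply: le_trans (P0 _ _ h) _; rewrite -addrA lerDl addr_ge0.
exists be; split.
- move=> p q pqk; split; first by apply/P0/rks.
  move: (pqk) => /andP[pq qk].
  apply: bigmax_le => [|r qr]; first exact: bigmax_ge_id.
  by apply: be_ge; rewrite (leq_trans pq qr) /=.
- move=> p pk; split=> //; first exact: bigmax_ge_id.
    by apply: be_ge; rewrite leqnn.
  rewrite lerBlDr; apply: bigmax_le => [|q pq]; first by rewrite addr_ge0.
  rewrite lerBlDr; apply: late => //; apply: rks; exact/andP.
move=> p pk; set l := nth j0 s p.
apply: (le_trans _ (P2 l i)).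
rewrite (bigID (mem s)) /= -[leLHS]addr0 lerD //; last first.
  by apply: sumr_ge0 => j _; rewrite le_max lexx.
rewrite -(big_uniq _ us) /= (big_nth j0); apply: ler_sum_nat => q qk.
rewrite ge_max le_max lexx /= /fr_term; set x := nth j0 s q.
case: ltnP => h; last first.
  by rewrite (P4 l x) ?le_max ?lexx ?orbT //; apply: rks; rewrite h.
set M := Num.max 0 _.
have M0 : 0 <= M by rewrite le_max lexx.
have MM : cur l x - c i x <= M by rewrite le_max lexx orbT.
have xl : (rk x <= rk l)%N by apply: rks; rewrite (ltnW h).
rewrite lerBlDr; apply: bigmax_le => [|m pm].
  by rewrite addr_ge0 // mulr_ge0.
have lm : (rk l <= rk (nth j0 s m))%N by apply: rks; rewrite pm /=.
(* If [x] is connected strictly earlier, its cost only falls until [m] is connected, when the detour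
   bound applies to [m]. If [x] ties with [l], its snapshot value is still the full budget and
   [late] takes over. *)
rewrite lerBlDr; case: (ltnP (rk x) (rk l)) => hx.
  have := P3 _ _ i (leq_trans hx lm); have := P1 _ _ _ lm hx.
  by rewrite -/(d q) -/(d m) -/(al m) in MM *; lra.
have := late x (nth j0 s m) (leq_trans xl lm); have := P0 _ _ xl.
have := P4 _ _ hx.
by rewrite -/(d q) -/(d m) -/(al m) in MM *; lra.
Qed.
Lemma jms_history_star u rk cur (i : F) (S : {set C}) :
    jms_history u rk cur -> (forall j, 0 <= u j) ->
  \sum_(j in S) u j <= 274 / 247 * f i + 439 / 247 * \sum_(j in S) c i j.
Proof.
move=> hist u0; pose s := sort (relpre rk leq) (enum S).
have sumE (g : C -> R) j0 :
    \sum_(j in S) g j = \sum_(0 <= p < size s) g (nth j0 s p).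
  have ps : perm_eq s (enum S) by rewrite perm_sort.
  by rewrite -(big_nth j0 xpredT) (perm_big _ ps) big_enum.
case: (set_0Vmem S) => [->|[j0 j0S]].
  by rewrite !big_set0 mulr0 addr0 mulr_ge0 ?divr_ge0.
have us : uniq s by rewrite sort_uniq enum_uniq.
have srt : sorted (relpre rk leq) s.
  by apply: sort_sorted => a b; exact: leq_total.
have [be sys] := @jms_history_fr_system u rk cur i s j0 hist u0 srt us.
rewrite !(sumE _ j0); apply: fr_bound sys.
by rewrite size_sort -cardE; apply/card_gt0P; exists j0.
Qed.

Lemma jms_bifactor (x : F -> C -> R) (y : F -> R) (S : {set F}) (a : C -> F) :
    lp_feasible x y -> (forall i, 0 <= y i) -> jms_run f c S a ->
  solution_cost f c S a
    <= 274 / 247 * facility_cost f y + 439 / 247 * connection_cost c x.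
Proof.
move=> [x1 xy x0] y0 /jms_run_history [u [rk [cur [hist u0 hcost]]]].
apply: le_trans hcost _.
have star i : \sum_j Num.max 0 (u j - 439 / 247 * c i j) <= 274 / 247 * f i.
  (* Exactly the clients with a positive term, so the star inequality bounds the sum of positive
     parts. *)
  have := jms_history_star i [set j | 439 / 247 * c i j < u j] hist u0.
  rewrite -lerBlDr mulr_sumr -sumrB => h; apply: le_trans h.
  rewrite [leRHS]big_mkcond /=; apply: ler_sum => j _; rewrite inE.
  by case: ltP => h; rewrite ge_max; apply/andP; split; lra.
rewrite /facility_cost /connection_cost !mulr_sumr -big_split /=.
have -> : \sum_j u j = \sum_i \sum_j x i j * u j.
  by rewrite exchange_big; apply: eq_bigr => j _; rewrite -mulr_suml x1 mul1r.
apply: ler_sum => i _; rewrite -lerBlDr mulr_sumr -sumrB.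
apply: (@le_trans _ _ (y i * \sum_j Num.max 0 (u j - 439 / 247 * c i j))).
  rewrite mulr_sumr; apply: ler_sum => j _.
  have -> : x i j * u j - 439 / 247 * (c i j * x i j)
          = x i j * (u j - 439 / 247 * c i j) by ring.
  apply: (@le_trans _ _ (x i j * Num.max 0 (u j - 439 / 247 * c i j))).
    by rewrite ler_wpM2l // le_max lexx orbT.
  by rewrite ler_wpM2r // le_max lexx.
by rewrite mulrA [leRHS]mulrC ler_wpM2l // star.
Qed.
End JMS.

(** * Independent blocks of facilities *)

Section SubsetSums.
Variables (R : comPzRingType) (I : finType).

Lemma sum_subset_split (U A : {set I}) (f g : {set I} -> R) :
    A \subset U ->
  \sum_(S : {set I} | S \subset U) f (S :&: A) * g (S :\: A) =
  (\sum_(T : {set I} | T \subset A) f T) *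
  (\sum_(T : {set I} | T \subset U :\: A) g T).
Proof.
move=> AU; rewrite mulr_suml.
rewrite (partition_big (fun S => S :&: A) (fun T => T \subset A)) /=; last first.
  by move=> S _; exact: subsetIr.
apply: eq_bigr => T TA; rewrite mulr_sumr.
rewrite (reindex_onto (fun V => T :|: V) (fun S => S :\: A)) /=; last first.
  move=> S /andP[_ /eqP <-]; exact: setID.
have simp (V : {set I}) : V \subset U :\: A ->
    (T :|: V) :&: A = T /\ (T :|: V) :\: A = V.
  rewrite subsetD => /andP[VU dVA]; rewrite setIUl (setIidPl TA) setDUl.
  have -> : V :&: A = set0 by apply/eqP; rewrite setI_eq0.
  have -> : T :\: A = set0 by apply/eqP; rewrite setD_eq0.
  by rewrite setU0 set0U (setDidPl dVA).
have cond (V : {set I}) : ((T :|: V) \subset U) && ((T :|: V) :&: A == T)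
    && ((T :|: V) :\: A == V) = (V \subset U :\: A).
  apply/idP/idP => [/andP[/andP[h1 _] /eqP <-]|h]; first by rewrite setSD.
  have [-> ->] := simp V h; rewrite !eqxx !andbT subUset (subset_trans TA AU).
  by apply: subset_trans h _; exact: subsetDl.
apply: eq_big => [V|V]; first exact: cond.
by rewrite cond => /simp [-> ->].
Qed.

Lemma prod_subset_distr (U : {set I}) (a b : I -> R) :
  \sum_(S : {set I} | S \subset U) \prod_(i in U) (if i \in S then a i else b i)
    = \prod_(i in U) (a i + b i).
Proof.
rewrite [RHS]big_mkcond /=.
rewrite (eq_bigr (fun i => (if i \in U then a i else 0) +
                           (if i \in U then b i else 1))) => [|i _]; last first.
  by case: ifP; rewrite ?add0r.
rewrite bigA_distr /= [RHS](bigID (fun S : {set I} => S \subset U)) /=.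
rewrite [X in _ + X]big1 ?addr0 => [|S /subsetPn[i iS iU]]; last first.
  by rewrite (bigD1 i) //= iS (negbTE iU) mul0r.
apply: eq_big => [S|S SU]; first by [].
rewrite big_mkcond /=; apply: eq_bigr => i _.
case: ifP => iU; first by case: ifP.
by case: ifP => // iS; rewrite (subsetP SU) in iU.
Qed.
End SubsetSums.

Section Opening.
Variables (R : realType) (I C : finType) (xb : I -> C -> R) (yb : I -> R).
Local Notation close j := (close xb j).

Definition cut01 (p : R) : R := Num.max 0 (Num.min 1 p).

Lemma cut01_bounds p : 0 <= cut01 p <= 1.
Proof. by rewrite /cut01 le_max lexx ge_max ge_min lexx ler01. Qed.

Lemma cut01_le p : 0 <= p -> cut01 p <= p.
Proof. by move=> p0; rewrite /cut01 ge_max p0 ge_min lexx orbT. Qed.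

Lemma cut01_ge p q : 0 <= q <= p -> q <= 1 -> q <= cut01 p.
Proof. by move=> /andP[q0 qp] q1; rewrite /cut01 le_max le_min q1 qp orbT. Qed.

Definition disjoint_clusters (K : seq C) : bool :=
  pairwise (fun j k => [disjoint close j & close k]) K.

Lemma big_clusters (T : Type) (idx : T) (op : Monoid.com_law idx) (K : seq C)
    (S : {set I}) (F : I -> T) :
    disjoint_clusters K ->
  \big[op/idx]_(i in S) F i =
  op (\big[op/idx]_(j <- K) \big[op/idx]_(i in S :&: close j) F i)
     (\big[op/idx]_(i in S | ~~ has (fun j => i \in close j) K) F i).
Proof.
move=> dK; rewrite (bigID (fun i => has (fun j => i \in close j) K)) /=.
congr (op _ _); elim: K dK => [|j K IH].
  by rewrite big_nil big_pred0 // => i; rewrite andbF.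
rewrite /disjoint_clusters pairwise_cons => /andP[/allP dj dK].
rewrite big_cons -IH // (bigID (mem (close j))) /=; congr (op _ _).
  by apply: eq_bigl => i; rewrite in_setI; case: (i \in close j) => /=;
     rewrite ?andbF ?andbT.
apply: eq_bigl => i; case ij: (i \in close j) => /=; rewrite ?andbF ?andbT //.
apply/esym/negP => /andP[_ /hasP[k kK ik]].
by have := disjointFr (dj k kK) ij; rewrite ik.
Qed.

(** The probability generating function of the random set of opened facilities, in product form.
    With z i the probability of disregarding [i] when it is open, it is the probability that no open
    facility counts. *)
Definition opening_gf (K : seq C) (z : I -> R) : R :=
  (\prod_(j <- K) \sum_(i in close j) xb i j * z i) *
  \prod_(i | ~~ has (fun j => i \in close j) K)
    (1 - cut01 (yb i) + cut01 (yb i) * z i).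

Let cluster (z : I -> R) (j : C) (T : {set I}) : R :=
  (\sum_(i in close j | T == [set i]) xb i j) * \prod_(i in T) z i.

Let sum_cluster z j :
  \sum_(T : {set I} | T \subset close j) cluster z j T
    = \sum_(i in close j) xb i j * z i.
Proof.
rewrite /cluster; under eq_bigr do rewrite mulr_suml.
rewrite (exchange_big_dep (mem (close j))) /=; last by move=> T i _ /andP[].
apply: eq_bigr => i ij; rewrite (big_pred1 [set i]) ?big_set1 // => T /=.
by rewrite ij /=; case: eqP => [->|]; rewrite ?andbF // sub1set ij.
Qed.

Let gf_in (K : seq C) (U : {set I}) (z : I -> R) :
    disjoint_clusters K -> (forall j, j \in K -> close j \subset U) ->
  \sum_(S : {set I} | S \subset U)
     (\prod_(j <- K) cluster z j (S :&: close j)) *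
     \prod_(i in U | ~~ has (fun j => i \in close j) K)
       (if i \in S then cut01 (yb i) * z i else 1 - cut01 (yb i))
  = (\prod_(j <- K) \sum_(i in close j) xb i j * z i) *
    \prod_(i in U | ~~ has (fun j => i \in close j) K)
      (cut01 (yb i) * z i + (1 - cut01 (yb i))).
Proof.
elim: K U => [|j K IH] U dK KU.
  have e i : (i \in U) && ~~ has (fun j => i \in close j) [::] = (i \in U).
    by rewrite andbT.
  rewrite big_nil mul1r (eq_bigl _ _ e) -prod_subset_distr.
  by apply: eq_bigr => S _; rewrite big_nil mul1r (eq_bigl _ _ e).
move: dK; rewrite /disjoint_clusters pairwise_cons => /andP[/allP dj dK].
have jU : close j \subset U by apply: KU; rewrite mem_head.
pose V := U :\: close j.
have predE i : (i \in U) && ~~ has (fun k => i \in close k) (j :: K)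
    = (i \in V) && ~~ has (fun k => i \in close k) K.
  by rewrite /= in_setD negb_or; case: (i \in U); case: (i \in close j).
rewrite (eq_bigl _ _ predE) big_cons -mulrA.
rewrite -IH => //; last first.
  move=> k kK; rewrite subsetD KU ?inE ?kK ?orbT //=.
  by rewrite disjoint_sym dj.
rewrite -sum_cluster -sum_subset_split //.
apply: eq_bigr => S SU; rewrite big_cons -mulrA; congr (_ * _).
rewrite (eq_bigl _ _ predE); congr (_ * _).
  apply: eq_big_seq => k kK; congr cluster.
  have := dj k kK; rewrite disjoint_sym -setI_eq0 => /eqP e.
  by rewrite setIDAC -setIDA; congr (_ :&: _); apply/esym/setDidPl;
     rewrite -setI_eq0 e.
by apply: eq_bigr => i /andP[]; rewrite !inE => /andP[/negbTE -> _] _.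
Qed.

Lemma opening_probM (K : seq C) (z : I -> R) :
    disjoint_clusters K ->
  \sum_(S : {set I}) opening_prob xb yb K S * \prod_(i in S) z i
    = opening_gf K z.
Proof.
move=> dK; have := @gf_in K setT z dK (fun j _ => subsetT _).
rewrite (eq_bigl _ _ (fun S : {set I} => subsetT S)) => h; rewrite /opening_gf.
transitivity ((\prod_(j <- K) \sum_(i in close j) xb i j * z i) *
    \prod_(i in [set: I] | ~~ has (fun j => i \in close j) K)
      (cut01 (yb i) * z i + (1 - cut01 (yb i)))); last first.
  congr (_ * _); apply: eq_big => [i|i _]; first by rewrite inE.
  by rewrite addrC.
rewrite -h; apply: eq_bigr => S _.
rewrite (big_clusters _ S z dK) /=.
rewrite /opening_prob mulrACA; congr (_ * _).
  by rewrite -big_split.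
rewrite [X in _ * X = _]big_mkcondl -big_split /=.
apply: eq_big => [i|i hi]; first by rewrite inE.
by rewrite -/(cut01 _); case: ifP => _; rewrite ?mulr1.
Qed.
End Opening.

Section Blocks.
Variables (R : realType) (I C : finType) (xb : I -> C -> R) (K : seq C).
Local Notation close j := (close xb j).
Hypothesis dK : disjoint_clusters xb K.

(** The probability that none of the shares [v] opens: openings exclude each other within a cluster,
    so shares add there, and they are independent elsewhere. *)
Definition block_prod (v : I -> R) : R :=
  (\prod_(j <- K) (1 - \sum_(i in close j) v i)) *
  \prod_(i | ~~ has (fun j => i \in close j) K) (1 - v i).

Definition block_le1 (v : I -> R) : Prop :=
  (forall j, j \in K -> \sum_(i in close j) v i <= 1) /\ (forall i, v i <= 1).

Lemma sum_clusters (v : I -> R) :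
  \sum_i v i = \sum_(j <- K) \sum_(i in close j) v i +
               \sum_(i | ~~ has (fun j => i \in close j) K) v i.
Proof.
transitivity (\sum_(i in [set: I]) v i).
  by apply: eq_bigl => i; rewrite inE.
rewrite (big_clusters _ setT v dK) /=; congr (_ + _); last first.
  by apply: eq_bigl => i; rewrite inE.
by apply: eq_bigr => j _; rewrite setTI.
Qed.

Lemma block_prod_ge0 (v : I -> R) : block_le1 v -> 0 <= block_prod v.
Proof.
move=> [h1 h2]; apply: mulr_ge0.
  by rewrite big_seq; apply: prodr_ge0 => j jK; rewrite subr_ge0 h1.
by apply: prodr_ge0 => i _; rewrite subr_ge0.
Qed.

Lemma block_prod_le_exp (v : I -> R) :
  block_le1 v -> block_prod v <= expR (- \sum_i v i).
Proof.
move=> [h1 h2]; rewrite sum_clusters opprD expRD.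
have key (x : R) : x <= 1 -> 0 <= 1 - x <= expR (- x).
  by move=> h; rewrite subr_ge0 h expR_ge1Dx.
pose P (p s : R) := 0 <= p <= expR (- s).
have P0 : P 1 0 by rewrite /P oppr0 expR0 ler01 lexx.
have PM p s p' s' : P p s -> P p' s' -> P (p * p') (s + s').
  move=> /andP[p0 ps] /andP[p0' ps']; rewrite /P mulr_ge0 //= opprD expRD.
  exact: ler_pM.
have /andP[a1 a2] : P (\prod_(j <- K) (1 - \sum_(i in close j) v i))
    (\sum_(j <- K) \sum_(i in close j) v i).
  by rewrite big_seq [X in P _ X]big_seq; apply: (big_ind2 P) => // j jK;
     apply/key/h1.
have /andP[b1 b2] : P (\prod_(i | ~~ has (fun j => i \in close j) K) (1 - v i))
    (\sum_(i | ~~ has (fun j => i \in close j) K) v i).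
  by apply: (big_ind2 P) => // i _; apply/key/h2.
exact: ler_pM.
Qed.

(* Along the segment from v to v - (N / M) mu the block product is a convex
   function, and the endpoint is estimated by the exponential. *)
Lemma block_prod_chord (v mu : I -> R) (N : R) :
    block_le1 v -> (forall i, 0 <= mu i) -> 0 < N -> \sum_i mu i <= N ->
  block_prod (fun i => v i - mu i) <=
    (1 - (\sum_i mu i) / N) * block_prod v
    + (\sum_i mu i) / N * expR (N - \sum_i v i).
Proof.
move=> hv mu0 N0; set M := \sum_i mu i => MN.
have M0 : 0 <= M by exact: sumr_ge0.
have [M00|Mp] : M = 0 \/ 0 < M by move: M0; rewrite le_eqVlt => /orP[/eqP|]; auto.
  have muE i : mu i = 0.
    by move/eqP: M00; rewrite psumr_eq0 // => /allP/(_ i (mem_index_enum _))/eqP.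
  rewrite M00 !mul0r addr0 subr0 mul1r /block_prod.
  under eq_bigr do under eq_bigr do rewrite muE subr0.
  by under [X in _ * X <= _]eq_bigr do rewrite muE subr0.
set s := M / N; have s0 : 0 < s by rewrite divr_gt0.
have s1 : s <= 1 by rewrite ler_pdivrMr // mul1r.
pose v' i := v i - mu i / s.
have [h1 h2] := hv.
have muS (A : {pred I}) : 0 <= \sum_(i in A) mu i by exact: sumr_ge0.
have v'le : block_le1 v'.
  split=> [j jK|i]; last first.
    by apply: le_trans (h2 i); rewrite gerBl divr_ge0 // ltW.
  apply: le_trans (h1 j jK); rewrite ler_sum // => i _.
  by rewrite gerBl divr_ge0 // ltW.
have Mv' : \sum_i v' i = \sum_i v i - N.
  rewrite sumrB -mulr_suml; congr (_ - _); rewrite -/M /s invfM invrK.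
  by rewrite mulrA divff ?mul1r // gt_eqF.
apply: (@le_trans _ _ ((1 - s) * block_prod v + s * block_prod v')); last first.
  rewrite lerD2l ler_wpM2l ?(ltW s0) //.
  by have := block_prod_le_exp v'le; rewrite Mv' opprB.
(* Below the chord in every factor implies below the chord in the product, because x and y are
   ordered the same way in all factors: the gain is s (1 - s)(y - x)(y' - x') >= 0. *)
pose P (t x y : R) := [/\ 0 <= t, 0 <= x, x <= y & t <= (1 - s) * x + s * y].
have P1 : P 1 1 1 by split=> //; lra.
have PM t x y t' x' y' : P t x y -> P t' x' y' -> P (t * t') (x * x') (y * y').
  move=> [t0 x0 xy ty] [t0' x0' xy' ty']; split; rewrite ?mulr_ge0 ?ler_pM //.
  apply: le_trans (ler_pM t0 t0' ty ty') _.
  have : 0 <= s * (1 - s) * ((y - x) * (y' - x')).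
    apply: mulr_ge0; apply: mulr_ge0; rewrite ?subr_ge0 //; exact: ltW.
  lra.
have key (a m : R) : a <= 1 -> 0 <= m ->
    P (1 - (a - m)) (1 - a) (1 - (a - m / s)).
  move=> a1 m0; have q0 : 0 <= m / s by rewrite divr_ge0 // ltW.
  have -> : m = s * (m / s) by rewrite mulrCA divff ?mulr1 // gt_eqF.
  rewrite [X in _ - X / s]mulrC mulfK ?gt_eqF //.
  by split; nra.
have [_ _ _ //] : P (block_prod (fun i => v i - mu i)) (block_prod v) (block_prod v').
apply: (PM).
  rewrite big_seq [X in P _ X _]big_seq [X in P _ _ X]big_seq.
  apply: (big_ind3 P) => // j jK; rewrite /v' !sumrB -mulr_suml.
  by apply: key => //; exact: h1.
by apply: (big_ind3 P) => // i _; apply: key.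
Qed.
End Blocks.

(** The order within a group of equal values of [h] is arbitrary, and tail sums can be controlled
    only where a new value begins; for a nondecreasing [h] that is enough. *)
Lemma abel_strict_ge0 (R : numDomainType) (w h : nat -> R) (n : nat) :
    (forall i, (i < n)%N -> 0 <= h i) ->
    (forall i j, (i <= j < n)%N -> h i <= h j) ->
    (forall p, (p < n)%N -> (forall i, (i < p)%N -> h i < h p) ->
       0 <= \sum_(p <= m < n) w m) ->
  0 <= \sum_(0 <= m < n) w m * h m.
Proof.
move=> h0 hd hw; case: n h0 hd hw => [|n] h0 hd hw; first by rewrite big_geq.
suff key q p : (p + q = n)%N ->
    h p * \sum_(p <= m < n.+1) w m <= \sum_(p <= m < n.+1) w m * h m.
  apply: le_trans (key n 0%N (add0n n)); apply: mulr_ge0; first exact: h0.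
  by apply: hw => // i; rewrite ltn0.
elim: q p => [|q IH] p pq.
  by rewrite -pq addn0 !big_nat1 mulrC.
have pn : (p < n.+1)%N by lia.
rewrite big_ltn // [leRHS]big_ltn // mulrDr (mulrC (w p)) lerD2l.
apply: le_trans (IH p.+1 _); last by lia.
have : h p <= h p.+1 by apply: hd; lia.
rewrite le_eqVlt => /orP[/eqP -> //|hlt].
apply: ler_wpM2r (ltW hlt); apply: hw => [|i hi]; first by lia.
by apply: le_lt_trans hlt; apply: hd; lia.
Qed.

Lemma disjoint_clusters_rem (R : realType) (I C : finType) (xb : I -> C -> R)
    (K : seq C) (j k : C) :
    disjoint_clusters xb K -> j \in K -> k \in rem j K ->
  [disjoint close xb j & close xb k].
Proof.
elim: K => [|a K IH] //; rewrite /disjoint_clusters pairwise_cons.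
move=> /andP[/allP da dK]; rewrite inE /=; case: eqVneq => [->|ja] /=.
  by move=> _ /da.
rewrite inE => jK /orP[/eqP ->|kK]; last exact: IH.
by rewrite disjoint_sym da.
Qed.

(** * Expected connection distance of a single client *)

Section Client.
Variables (R : realType) (I C : finType) (xb : I -> C -> R) (yb : I -> R).
Variable K : seq C.
Local Notation close j := (close xb j).
Hypothesis xb_ge0 : forall i j, 0 <= xb i j.
Hypothesis dK : disjoint_clusters xb K.
Hypothesis xyK : forall j i, j \in K -> i \in close j -> xb i j = yb i.
Hypothesis x1K : forall j, j \in K -> \sum_(i in close j) xb i j = 1.

Lemma opening_prob_ge0 (S : {set I}) : 0 <= opening_prob xb yb K S.
Proof.
apply: mulr_ge0; apply: prodr_ge0 => i _; first exact: sumr_ge0.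
by have /andP[] := cut01_bounds (yb i); rewrite /cut01; case: ifP; lra.
Qed.

Lemma opening_prob_meets (S : {set I}) (j : C) :
    j \in K -> S :&: close j = set0 -> opening_prob xb yb K S = 0.
Proof.
move=> jK Sj; rewrite /opening_prob (big_rem j jK) /=.
rewrite [X in X * _ * _]big_pred0 ?mul0r // => i; rewrite Sj.
by apply/negbTE; rewrite negb_and eq_sym -[X in _ || X]negbK negbK; apply/orP; right;
  apply/set0Pn; exists i; rewrite inE.
Qed.

Lemma cluster_yb_le1 j i : j \in K -> i \in close j -> 0 <= yb i <= 1.
Proof.
move=> jK ij; rewrite -(xyK jK ij) xb_ge0 /= -(x1K jK) (bigD1 i) //=.
by rewrite lerDl sumr_ge0.
Qed.

Lemma cut01_cluster j i : j \in K -> i \in close j -> cut01 (yb i) = yb i.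
Proof.
move=> jK ij; have /andP[y0 y1] := cluster_yb_le1 jK ij.
by rewrite /cut01 min_r // max_r.
Qed.

Lemma opening_gf_block_prod (v z : I -> R) :
    (forall i, cut01 (yb i) * (1 - z i) = v i) ->
  opening_gf xb yb K z = block_prod xb K v.
Proof.
move=> hv; congr (_ * _); last first.
  by apply: eq_bigr => i _; rewrite -hv; ring.
apply: eq_big_seq => j jK; rewrite -(x1K jK) -sumrB; apply: eq_bigr => i ij.
by rewrite -hv (cut01_cluster jK ij) (xyK jK ij); ring.
Qed.

Lemma opening_probM_in (z : I -> R) (j : C) (e : I -> R) :
    j \in K ->
  exists2 rest, opening_gf xb yb K z = rest * \sum_(i in close j) xb i j * z i
    & \sum_(S : {set I}) opening_prob xb yb K S *
         ((\prod_(i in S) z i) * \sum_(i in S :&: close j) e i)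
        = rest * \sum_(i in close j) e i * (xb i j * z i).
Proof.
move=> jK; pose rest := (\prod_(k <- rem j K) \sum_(i in close k) xb i k * z i) *
  \prod_(i | ~~ has (fun j => i \in close j) K)
    (1 - cut01 (yb i) + cut01 (yb i) * z i).
exists rest.
  by rewrite /opening_gf (big_rem j jK) /= /rest; ring.
(* Setting the variable of [i] to 0 removes the sets containing [i], so the difference of the two
   generating functions isolates the event that [i] is open. *)
pose zo i k := if k == i then 0 else z k.
have zoi i : zo i i = 0 by rewrite /zo eqxx.
have gfo i : i \in close j -> opening_gf xb yb K (zo i)
    = rest * \sum_(k in close j) xb k j * zo i k.
  move=> ij; rewrite /opening_gf (big_rem j jK) /= /rest.
  rewrite (eq_big_seq (fun l => \sum_(k in close l) xb k l * z k)); last first.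
    move=> l lK; apply: eq_bigr => k kl; rewrite /zo.
    case: eqP => // e'; have := disjointFr (disjoint_clusters_rem dK jK lK) ij.
    by rewrite -e' kl.
  rewrite [X in _ * X = _](eq_bigr (fun k => 1 - cut01 (yb k) + cut01 (yb k) * z k)).
    by ring.
  move=> k kK; rewrite /zo; case: eqP => // e'.
  by case/hasP: kK; exists j => //; rewrite e'.
rewrite mulr_sumr.
transitivity (\sum_(i in close j) e i *
    (opening_gf xb yb K z - opening_gf xb yb K (zo i))); last first.
  apply: eq_bigr => i ij; rewrite (gfo i ij) {1}/opening_gf (big_rem j jK) /=.
  rewrite (bigD1 i) //= [X in _ - _ * X](bigD1 i) //= zoi mulr0 add0r.
  have -> : \sum_(k in close j | k != i) xb k j * zo i k
      = \sum_(k in close j | k != i) xb k j * z k.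
    by apply: eq_bigr => k /andP[_ /negbTE ki]; rewrite /zo ki.
  by rewrite /rest; ring.
under eq_bigr do rewrite mulr_sumr mulr_sumr.
rewrite (exchange_big_dep (mem (close j))) /=; last first.
  by move=> S i _; rewrite inE => /andP[].
apply: eq_bigr => i ij; rewrite -!opening_probM // -sumrB mulr_sumr big_mkcond /=.
apply: eq_bigr => S _; rewrite inE ij andbT; case: ifP => iS.
  rewrite [X in _ - _ * X](bigD1 i) //= zoi mul0r mulr0 subr0; ring.
rewrite (eq_bigr (zo i)) ?subrr ?mulr0 // => k kS; rewrite /zo; case: eqP => // e'.
by rewrite -e' kS in iS.
Qed.

Lemma block_le1_le (v w : I -> R) :
    block_le1 xb K w -> (forall i, v i <= w i) -> block_le1 xb K v.
Proof.
move=> [h1 h2] vw; split=> [j jK|i]; last exact: le_trans (vw i) (h2 i).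
by apply: le_trans (h1 j jK); apply: ler_sum => i _.
Qed.

Section ExpectedDistance.
Variables (g H B Dd : R) (h a d : I -> R) (jn : C) (cost : {set I} -> R).
Hypothesis g_gt1 : 1 < g.
Hypothesis h_ge0 : forall i, 0 <= h i.
Hypothesis a_ge0 : forall i, 0 <= a i.
Hypothesis d_ge0 : forall i, 0 <= d i.
Hypothesis ad_yb : forall i, a i + d i <= yb i.
Hypothesis ad_le1 : forall i, a i + d i <= 1.
Hypothesis sum_a : \sum_i a i = 1.
Hypothesis sum_d : \sum_i d i = g - 1.
Hypothesis a_near : forall i, 0 < a i -> h i <= H.
Hypothesis d_far : forall i, 0 < d i -> H <= h i.
Hypothesis Dd_def : Dd * (g - 1) = \sum_i d i * h i.
Hypothesis Dd_le : Dd <= B.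
Hypothesis jnK : jn \in K.
Hypothesis fallback : \sum_(i in close jn) h i * (yb i - (a i + d i))
  <= B * \sum_(i in close jn) (yb i - (a i + d i)).
Hypothesis cost_le : forall (S : {set I}) i, i \in S -> cost S <= h i.

(** An open facility [i] counts with probability w i / cut01 (yb i), hence with probability [w i]
    overall, and [z i] is the probability of disregarding it. In the order [L] of increasing
    distance, [T m S] is the probability, given [S], that none of the first [m] facilities counts;
    [t m] is its mean, and [q] the probability that nothing counts. *)
Let w i := a i + d i.
Let z i := 1 - w i / cut01 (yb i).
Let L := sort (fun i k => h i <= h k) (enum I).
Let n := size L.
Let zm m i := if i \in take m L then z i else 1.
Let T m (S : {set I}) := \prod_(i in S) zm m i.
Let t m := block_prod xb K (fun i => if i \in take m L then w i else 0).
Let E : R := (expR 1)^-1.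
Let q := block_prod xb K w.

Let w_ge0 i : 0 <= w i. Proof. exact: addr_ge0. Qed.

Let w_cut i : w i <= cut01 (yb i).
Proof. by apply: cut01_ge (ad_le1 i); rewrite w_ge0 ad_yb. Qed.

Let cut_z i : cut01 (yb i) * (1 - z i) = w i.
Proof.
rewrite /z opprB addrCA subrr addr0 mulrCA.
case: (eqVneq (cut01 (yb i)) 0) => [e|ne]; last by rewrite divff ?mulr1.
by rewrite e mul0r mulr0; apply/eqP; rewrite eq_le w_ge0 -e w_cut.
Qed.

Let z_bounds i : 0 <= z i <= 1.
Proof.
have c0 : 0 <= cut01 (yb i) by have /andP[] := cut01_bounds (yb i).
rewrite /z subr_ge0 gerBl divr_ge0 // andbT.
case: (eqVneq (cut01 (yb i)) 0) => [->|ne]; first by rewrite invr0 mulr0.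
by rewrite ler_pdivrMr ?mul1r // lt_neqAle eq_sym ne.
Qed.

Let wle1 : block_le1 xb K w.
Proof.
split=> [j jK|i]; last exact: ad_le1.
rewrite -(x1K jK); apply: ler_sum => i ij.
by rewrite (xyK jK ij) ad_yb.
Qed.

Let uL : uniq L. Proof. by rewrite sort_uniq enum_uniq. Qed.
Let memL i : i \in L. Proof. by rewrite mem_sort mem_enum. Qed.

Let sumL (f : I -> R) i0 : \sum_i f i = \sum_(0 <= m < n) f (nth i0 L m).
Proof.
have ps : perm_eq L (enum I) by rewrite perm_sort.
by rewrite -(big_nth i0 xpredT) (perm_big _ ps) big_enum.
Qed.

Let sortedL i0 m k : (m <= k < n)%N -> h (nth i0 L m) <= h (nth i0 L k).
Proof.
move=> /andP[mk kn].
have tr : transitive (fun i k : I => h i <= h k) by move=> x y u; exact: le_trans.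
have rf : reflexive (fun i k : I => h i <= h k) by move=> x; exact: lexx.
have srt : sorted (fun i k => h i <= h k) L.
  by apply: sort_sorted => x y; exact: le_total.
by apply: (sorted_leq_nth tr rf i0 srt) => //; rewrite inE // (leq_ltn_trans mk).
Qed.

Let T_step m S i0 : (m < n)%N ->
  T m.+1 S = T m S * (if nth i0 L m \in S then z (nth i0 L m) else 1).
Proof.
move=> mn; set k := nth i0 L m.
have kt : k \notin take m L.
  by rewrite in_take ?memL // index_uniq // ltnn.
have zS i : zm m.+1 i = zm m i * (if i == k then z i else 1).
  rewrite /zm (take_nth i0 mn) mem_rcons inE -/k.
  by case: eqVneq => [->|_] /=; rewrite ?(negbTE kt) ?mul1r ?mulr1.
rewrite /T (eq_bigr _ (fun i _ => zS i)) big_split /=; congr (_ * _).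
case: ifP => kS.
  by rewrite (bigD1 k) //= eqxx big1 ?mulr1 // => i /andP[_ /negbTE ->].
by rewrite big1 // => i iS; case: eqP => // e; rewrite -e iS in kS.
Qed.

Let T_ge0 m S : 0 <= T m S.
Proof.
apply: prodr_ge0 => i _; rewrite /zm; case: ifP => // _.
by have /andP[] := z_bounds i.
Qed.

(** T m S - T m.+1 S is the probability that the first counted facility has index [m]; it is then
    open, so the cost is at most its distance. If nothing counts, the facility opened in the cluster
    of [jn] is used, which exists unless [S] has probability 0. *)
Let pointwise S i0 : opening_prob xb yb K S * cost S <=
  opening_prob xb yb K S *
    (\sum_(0 <= m < n) (T m S - T m.+1 S) * h (nth i0 L m)
     + T n S * \sum_(i in S :&: close jn) h i).
Proof.
have [Sj|[k kS]] := set_0Vmem (S :&: close jn).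
  by rewrite (opening_prob_meets jnK Sj) !mul0r.
rewrite ler_wpM2l ?opening_prob_ge0 //.
have T0 : T 0 S = 1 by rewrite /T big1 // => i _; rewrite /zm take0.
have -> : cost S = \sum_(0 <= m < n) (T m S - T m.+1 S) * cost S + T n S * cost S.
  rewrite -mulr_suml -mulrDl.
  have := @telescope_sumr R 0 n (fun m => T m S) (leq0n _) => tel.
  under eq_bigr do rewrite -opprB.
  by rewrite sumrN tel T0; ring.
apply: lerD.
  apply: ler_sum_nat => m /andP[_ mn]; rewrite (T_step S i0 mn).
  case: ifP => iS; last by rewrite mulr1 subrr !mul0r.
  rewrite ler_wpM2l ?cost_le //.
  have /andP[_ z1] := z_bounds (nth i0 L m).
  by rewrite subr_ge0 ler_piMr ?T_ge0.
rewrite ler_wpM2l ?T_ge0 // (bigD1 k) //=.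
have : cost S <= h k by apply: cost_le; move: kS; rewrite inE => /andP[].
have : 0 <= \sum_(i in S :&: close jn | i != k) h i by exact: sumr_ge0.
lra.
Qed.

Let expected_T m : \sum_S opening_prob xb yb K S * T m S = t m.
Proof.
rewrite opening_probM //; apply: opening_gf_block_prod => i.
by rewrite /zm; case: ifP => _; rewrite ?cut_z // subrr mulr0.
Qed.

Let tn : t n = q.
Proof.
congr (_ * _).
  apply: eq_bigr => j _; congr (1 - _); apply: eq_bigr => i _.
  by rewrite /n take_size memL.
by apply: eq_bigr => i _; rewrite /n take_size memL.
Qed.

Let expected_fallback :
  \sum_S opening_prob xb yb K S * (T n S * \sum_(i in S :&: close jn) h i) <= B * q.
Proof.
have [rest e1 e2] := opening_probM_in z h jnK.
have zn S : T n S = \prod_(i in S) z i.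
  by apply: eq_bigr => i _; rewrite /zm /n take_size memL.
under eq_bigr do rewrite zn; rewrite e2.
have xz i : i \in close jn -> xb i jn * z i = yb i - w i.
  move=> ij; rewrite -(cut_z i) (cut01_cluster jnK ij) (xyK jnK ij); ring.
have q_rest : q = rest * \sum_(i in close jn) (yb i - w i).
  rewrite /q -(opening_gf_block_prod cut_z) e1; congr (_ * _).
  exact: eq_bigr.
have q0 : 0 <= q by exact: block_prod_ge0.
have s0 : 0 <= \sum_(i in close jn) (yb i - w i).
  by apply: sumr_ge0 => i _; rewrite subr_ge0 ad_yb.
rewrite (eq_bigr (fun i => h i * (yb i - (a i + d i)))) => [|i ij]; last first.
  by rewrite xz.
case: (ltgtP 0 (\sum_(i in close jn) (yb i - w i))) s0 => // [sp|s00] _.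
  rewrite q_rest mulrCA; apply: ler_wpM2l fallback.
  by move: q0; rewrite q_rest pmulr_lge0.
rewrite q_rest -s00 !mulr0.
rewrite big1 ?mulr0 // => i ij.
have /eqP := esym s00; rewrite psumr_eq0 => [/allP/(_ i (mem_index_enum _))|k _].
  by rewrite ij /= /w => /eqP ->; rewrite mulr0.
by rewrite subr_ge0 ad_yb.
Qed.

(** The comparison law: mass 1 - E spread over the close shares, of total 1, and E - q over the
    distant shares, of total g - 1. It is to put at least as much mass far away as the law of the
    first counted facility. *)
Let r i := (1 - E) * a i + (E - q) / (g - 1) * d i.

Let dominance p i0 : (p < n)%N ->
    (forall m, (m < p)%N -> h (nth i0 L m) < h (nth i0 L p)) ->
  t p - q <= \sum_(p <= m < n) r (nth i0 L m).
Proof.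
move=> pn strict.
have in_takeE i : (i \in take p L) = (index i L < p)%N by rewrite in_take.
have tailE (f : I -> R) :
    \sum_(p <= m < n) f (nth i0 L m) = \sum_i (if i \in take p L then 0 else f i).
  rewrite (sumL _ i0) [RHS](@big_cat_nat _ _ _ p) ?(ltnW pn) //=.
  rewrite [X in _ = X + _]big_nat [X in _ = X + _]big1 => [|m /andP[_ mp]]; last first.
    by rewrite /= in_takeE index_uniq ?mp // (ltn_trans mp).
  rewrite add0r; apply: eq_big_nat => m /andP[pm mn].
  by rewrite /= in_takeE index_uniq // ltnNge pm.
have gap i k : i \in take p L -> k \notin take p L -> h i < h k.
  rewrite !in_takeE -leqNgt => ip pk.
  have := strict _ ip; rewrite nth_index ?memL // => /lt_le_trans; apply.
  rewrite -[in leRHS](nth_index i0 (memL k)); apply: sortedL.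
  by rewrite pk index_mem memL.
have g1 : 0 < g - 1 by rewrite subr_gt0.
have bp_ext v v' : v =1 v' -> block_prod xb K v = block_prod xb K v'.
  move=> e; congr (_ * _); last by apply: eq_bigr => i _; rewrite e.
  by apply: eq_bigr => j _; congr (1 - _); apply: eq_bigr => i _; exact: e.
rewrite tailE.
(* If a close share lies beyond the first [p] facilities, the strict gap in distance keeps distant
   shares out of these [p], and the chord is taken over the close shares alone, with N = 1. *)
have [/existsP[k /andP[kp ak]]|none] :=
  boolP [exists k, (k \notin take p L) && (0 < a k)].
- pose mu i := if i \in take p L then 0 else a i.
  have d0 i : i \in take p L -> d i = 0.
    move=> ip; apply/eqP; rewrite eq_le d_ge0 andbT leNgt; apply/negP => di.
    have := gap i k ip kp; rewrite ltNge.
    by rewrite (le_trans (a_near ak) (d_far di)).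
  have -> : t p = block_prod xb K (fun i => a i - mu i).
    apply: bp_ext => i; rewrite /mu /w; case: ifP => ip; last by rewrite subrr.
    by rewrite d0 // addr0 subr0.
  have mu0 i : 0 <= mu i by rewrite /mu; case: ifP.
  have mu1 : \sum_i mu i <= 1.
    by rewrite -sum_a; apply: ler_sum => i _; rewrite /mu; case: ifP.
  have ale : block_le1 xb K a.
    by apply: block_le1_le wle1 _ => i; rewrite lerDl.
  have := block_prod_chord dK ale mu0 ltr01 mu1.
  rewrite divr1 sum_a subrr expR0 mulr1.
  have := block_prod_le_exp dK ale; rewrite sum_a expRN -/E => hE h1.
  have -> : \sum_i (if i \in take p L then 0 else r i)
      = (1 - E) * \sum_i mu i + (E - q).
    transitivity (\sum_i ((1 - E) * mu i + (E - q) / (g - 1) * d i)).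
      apply: eq_bigr => i _; rewrite /mu /r; case: ifP => // ip.
      by rewrite d0 // !mulr0 addr0.
    by rewrite big_split /= -!mulr_sumr sum_d divfK ?gt_eqF.
  have : (1 - \sum_i mu i) * block_prod xb K a <= (1 - \sum_i mu i) * E.
    by rewrite ler_wpM2l // subr_ge0.
  lra.
(* Now all close shares are among the first [p] facilities, and the chord removes distant shares
   only, with N = g - 1. *)
pose mu i := if i \in take p L then 0 else d i.
have a0 i : i \notin take p L -> a i = 0.
  move=> ip; apply/eqP; rewrite eq_le a_ge0 andbT leNgt; apply/negP => ai.
  by move/negP: none; apply; apply/existsP; exists i; rewrite ip.
have -> : t p = block_prod xb K (fun i => w i - mu i).
  apply: bp_ext => i; rewrite /mu; case: ifP => ip; first by rewrite subr0.
  by rewrite /w a0 ?ip // add0r subrr.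
have mu0 i : 0 <= mu i by rewrite /mu; case: ifP.
have mu1 : \sum_i mu i <= g - 1.
  by rewrite -sum_d; apply: ler_sum => i _; rewrite /mu; case: ifP.
have := block_prod_chord dK wle1 mu0 g1 mu1.
have -> : g - 1 - \sum_i w i = -1 by rewrite big_split /= sum_a sum_d; ring.
rewrite expRN -/E -/q => h1.
have -> : \sum_i (if i \in take p L then 0 else r i)
    = (\sum_i mu i) / (g - 1) * (E - q).
  rewrite [RHS]mulrC mulrA [RHS]mulrAC mulr_sumr; apply: eq_bigr => i _.
  rewrite /mu /r; case: ifP => ip; first by rewrite mulr0.
  by rewrite a0 ?ip // mulr0 add0r.
lra.
Qed.

Lemma expected_distance :
  \sum_S opening_prob xb yb K S * cost S
    <= (1 - E) * (\sum_i a i * h i) + E * Dd + expR (- g) * (B - Dd).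
Proof.
have [i0 _] : exists i0 : I, i0 \in close jn.
  apply/set0Pn; apply: contra_eq_neq (x1K jnK) => ->.
  by rewrite big_set0 eq_sym oner_eq0.
have q_le : q <= expR (- g).
  have -> : - g = - \sum_i w i by rewrite big_split /= sum_a sum_d; ring.
  exact: block_prod_le_exp.
apply: (@le_trans _ _ (\sum_(0 <= m < n) (t m - t m.+1) * h (nth i0 L m) + B * q)).
  apply: le_trans (ler_sum _ (fun S _ => pointwise S i0)) _.
  under eq_bigr do rewrite mulrDr.
  rewrite big_split /= lerD ?expected_fallback //.
  under eq_bigr do rewrite mulr_sumr.
  rewrite exchange_big /=; apply: ler_sum => m _.
  rewrite -!expected_T -sumrB mulr_suml; apply: ler_sum => S _.
  by rewrite mulrA mulrBr.
have dom : \sum_(0 <= m < n) (t m - t m.+1) * h (nth i0 L m)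
    <= \sum_(0 <= m < n) r (nth i0 L m) * h (nth i0 L m).
  rewrite -subr_ge0 -sumrB; under eq_bigr do rewrite -mulrBl.
  apply: (@abel_strict_ge0 _ (fun m => r (nth i0 L m) - (t m - t m.+1))
    (fun m => h (nth i0 L m))) => //.
    by move=> i j; exact: sortedL.
  move=> p pn strict; rewrite sumrB subr_ge0.
  under eq_bigr do rewrite -opprB.
  rewrite sumrN telescope_sumr ?(ltnW pn) // opprB tn.
  exact: dominance.
have g1 : 0 < g - 1 by rewrite subr_gt0.
have rh : \sum_(0 <= m < n) r (nth i0 L m) * h (nth i0 L m)
    = (1 - E) * (\sum_i a i * h i) + (E - q) * Dd.
  rewrite -(sumL (fun i => r i * h i)).
  have -> : (E - q) * Dd = (E - q) / (g - 1) * \sum_i d i * h i.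
    by rewrite -Dd_def mulrA mulrAC -mulrA mulrA divfK ?gt_eqF // mulrC.
  rewrite !mulr_sumr -big_split /=; apply: eq_bigr => i _; rewrite /r; ring.
(* [q] enters with coefficient B - Dd >= 0, so its upper bound may be inserted. *)
have : q * (B - Dd) <= expR (- g) * (B - Dd) by rewrite ler_wpM2r // subr_ge0.
rewrite rh in dom; lra.
Qed.
End ExpectedDistance.
End Client.

(** * Algorithm A1 *)

(* Nothing close or distant to j is open, and the client j goes to the facility
   opened in the cluster Q of a neighbouring center: one detours through a
   facility of Q close or distant to j, chosen by averaging. *)
Lemma fallback_distance (R : realFieldType) (I : finType) (Q : {set I})
    (g H M' D' Dd : R) (y a d h h' : I -> R) (i0 : I) :
    g <= 2 -> (forall i, 0 <= a i) -> (forall i, 0 <= d i) ->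
    (forall i, a i + d i <= y i) -> \sum_(i in Q) y i = 1 ->
    \sum_(i in Q) y i * h' i = D' -> (forall i, i \in Q -> h' i <= M') ->
    (forall i l, h i <= h' i + h' l + h l) ->
    (forall i, 0 < a i -> h i <= H) -> (forall i, 0 < d i -> H <= h i) ->
    \sum_i d i = g - 1 -> Dd * (g - 1) = \sum_i d i * h i -> H <= Dd ->
    i0 \in Q -> 0 < a i0 ->
  \sum_(i in Q) h i * (y i - (a i + d i))
    <= (Dd + M' + D') * \sum_(i in Q) (y i - (a i + d i)).
Proof.
move=> g2 a0 d0 ady y1 yh' h'M tri near far sd dh HD i0Q ai0.
pose rho i := y i - (a i + d i).
have rho0 i : 0 <= rho i by rewrite subr_ge0.
set r := \sum_(i in Q) (y i - (a i + d i)).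
have r0 : 0 <= r by apply: sumr_ge0 => i _; exact: rho0.
have r1 : r <= 1.
  by rewrite -y1; apply: ler_sum => i _; rewrite gerBl addr_ge0.
have [rz|rp] : r = 0 \/ 0 < r by move: r0; rewrite le_eqVlt => /orP[/eqP|]; auto.
  rewrite rz mulr0 big1 // => i iQ.
  have /eqP := rz; rewrite psumr_eq0 => [/allP/(_ i (mem_index_enum _))|k _].
    by rewrite iQ /= => /eqP ->; rewrite mulr0.
  exact: rho0.
set s' := \sum_(i in Q) rho i * h' i.
have s'M : s' <= r * M'.
  by rewrite mulr_suml; apply: ler_sum => i iQ; rewrite ler_wpM2l ?h'M.
have via l : \sum_(i in Q) h i * (y i - (a i + d i)) <= s' + r * (h' l + h l).
  rewrite mulr_suml -big_split /=; apply: ler_sum => i _.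
  have := ler_wpM2r (rho0 i) (tri i l); rewrite /rho; lra.
have [hs|hs] := leP s' (r * (D' + (Dd - H))).
  apply: le_trans (via i0) _; have := near _ ai0; have := h'M _ i0Q => u v.
  have : r * (h' i0 + h i0) <= r * (M' + H) by rewrite ler_wpM2l ?lerD.
  lra.
rewrite leNgt; apply/negP => bad.
pose m := (Dd + M' + D') * r - s'.
have far_l l : m <= r * (h' l + h l) by have := via l; rewrite /m; lra.
have avg : (1 - r) * m <= r * \sum_(i in Q) (a i + d i) * (h' i + h i).
  have -> : 1 - r = \sum_(i in Q) (a i + d i) by rewrite /r sumrB y1; ring.
  rewrite mulr_suml mulr_sumr; apply: ler_sum => i _.
  by rewrite mulrCA ler_wpM2l ?far_l // addr_ge0.
have e1 : \sum_(i in Q) (a i + d i) * (h' i + h i)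
    = D' - s' + \sum_(i in Q) a i * h i + \sum_(i in Q) d i * h i.
  rewrite -yh' /s' -sumrB -!big_split /=; apply: eq_bigr => i _.
  by rewrite /rho; ring.
have e2 : \sum_(i in Q) a i * h i <= H * \sum_(i in Q) a i.
  rewrite mulr_sumr; apply: ler_sum => i _; rewrite mulrC.
  have := a0 i; rewrite le_eqVlt => /orP[/eqP <-|ai]; first by rewrite !mulr0.
  by rewrite ler_pM2r // near.
have e3 : \sum_(i in Q) d i * h i <= Dd * (g - 1) - H * (g - 1 - \sum_(i in Q) d i).
  have : H * \sum_(i | i \notin Q) d i <= \sum_(i | i \notin Q) d i * h i.
    rewrite mulr_sumr; apply: ler_sum => i _; rewrite mulrC.
    have := d0 i; rewrite le_eqVlt => /orP[/eqP <-|di]; first by rewrite !mul0r.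
    by rewrite ler_pM2l // far.
  have split_sum (e : I -> R) :
      \sum_i e i = \sum_(i in Q) e i + \sum_(i | i \notin Q) e i.
    by rewrite (bigID (mem Q)).
  rewrite dh -sd !split_sum; lra.
have e4 : \sum_(i in Q) a i + \sum_(i in Q) d i = 1 - r.
  by rewrite -big_split /= /r sumrB y1; ring.
have e5 : (1 - r) * m <= r * (D' - s' + H * (1 - r) + (g - 1) * (Dd - H)).
  apply: le_trans avg _; rewrite ler_wpM2l // e1 -e4; lra.
(* After division by [r], [e5] and [t1] give s' <= r (D' + Dd - H) + (g - 2)(Dd - H), which
   contradicts [hs] because g <= 2. *)
have t1 : 0 <= (1 - r) * (r * M' - s') by rewrite mulr_ge0 // subr_ge0.
have t2 : 0 <= r * ((2 - g) * (Dd - H)).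
  by rewrite !mulr_ge0 // subr_ge0.
have t3 : 0 < r * (s' - r * (D' + (Dd - H))) by rewrite mulr_gt0 // subr_gt0.
rewrite /m in e5; nra.
Qed.

(** * Greedy filling, splitting, clustering and opening costs *)

Section Greedy.
Variables (R : realType) (F : finType) (yt : F -> R).
Hypothesis yt_ge0 : forall i, 0 <= yt i.

Lemma greedy_fill_bounds s r i : 0 <= r -> 0 <= greedy_fill yt s r i <= yt i.
Proof.
elim: s r => [|k s IH] r r0 /=; first by rewrite lexx yt_ge0.
case: eqP => [->|_]; first by rewrite le_min r0 yt_ge0 ge_min lexx.
by apply: IH; rewrite subr_ge0 ge_min lexx orbT.
Qed.

Lemma greedy_fill_le s r r' i :
  r <= r' -> greedy_fill yt s r i <= greedy_fill yt s r' i.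
Proof.
elim: s r r' => [|k s IH] r r' rr //=.
case: eqP => _; first by rewrite le_min !ge_min lexx rr orbT.
apply: IH; rewrite lerBlDr -lerBlDl.
case: (leP (yt k) r); case: (leP (yt k) r'); lra.
Qed.

Lemma greedy_fill_sum s r :
    uniq s -> 0 <= r <= \sum_(k <- s) yt k ->
  \sum_(k <- s) greedy_fill yt s r k = r.
Proof.
elim: s r => [|k s IH] r /=.
  by rewrite !big_nil => _ /andP[h1 h2]; lra.
move=> /andP[ks us] /andP[r0]; rewrite !big_cons eqxx => hr.
rewrite (eq_big_seq (greedy_fill yt s (r - Num.min (yt k) r))) => [|i is_]; last first.
  by case: eqP => // e; rewrite -e is_ in ks.
rewrite IH //; first by rewrite addrC subrK.
have : 0 <= \sum_(j <- s) yt j by exact: sumr_ge0.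
by case: (leP (yt k) r) => h1 h2; apply/andP; split; lra.
Qed.

Lemma greedy_fill0 s i : greedy_fill yt s 0 i = 0.
Proof.
by elim: s => [|k s IH] //=; rewrite min_r // subr0 IH; case: eqP.
Qed.

(** A facility receives something only after all its predecessors in the list are full. *)
Lemma greedy_fill_order (le : rel F) s r i l :
    transitive le -> reflexive le -> sorted le s -> uniq s -> 0 <= r -> l \in s ->
    0 < greedy_fill yt s r i -> greedy_fill yt s r l < yt l -> le i l.
Proof.
move=> tr rf; elim: s r => [|k s IH] r //= srt /andP[ks us] r0.
have kall : all (le k) s by rewrite (path_sortedE tr) in srt; have /andP[] := srt.
have srt' : sorted le s by exact: path_sorted srt.
have inS : 0 < greedy_fill yt s (r - Num.min (yt k) r) i -> i \in s.
  elim: (s) (r - _) => [|a s' IH'] r' /=; first by rewrite ltxx.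
  by rewrite inE; case: eqP => //= _; exact: IH'.
rewrite inE; case: (eqVneq l k) => [->|lk] /=.
  case: (eqVneq i k) => [->|ik] //.
  case: (leP (yt k) r) => h; first by rewrite ltxx.
  by rewrite subrr greedy_fill0 ltxx.
move=> ls; case: (eqVneq i k) => [-> _ _|ik]; first exact: (allP kall).
by apply: IH => //; rewrite subr_ge0 ge_min lexx orbT.
Qed.
End Greedy.

(** Fractional knapsack with threshold price [tau], the largest cost at which [x] exceeds [z]: where
    [x] falls short of [z] it is below capacity, so the cost there is at least [tau]. *)
Lemma exchange_optimal (R : realFieldType) (F : finType) (cost yt x z : F -> R) :
    (forall i, 0 <= cost i) -> (forall i, 0 <= x i) -> (forall i, z i <= yt i) ->
    (forall i, 0 <= z i) ->
    (forall i l, 0 < x i -> x l < yt l -> cost i <= cost l) ->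
    \sum_i x i = \sum_i z i ->
  \sum_i cost i * x i <= \sum_i cost i * z i.
Proof.
move=> c0 x0 zy z0 ord e.
pose tau := \big[Num.max/0]_(i | z i < x i) cost i.
have : 0 <= \sum_i (cost i - tau) * (z i - x i).
  apply: sumr_ge0 => i _; case: (ltgtP (z i) (x i)) => h.
  - rewrite nmulr_lge0 ?subr_lt0 // subr_le0.
    exact: (@le_bigmax_cond _ _ _ _ i (fun i => z i < x i)).
  - rewrite mulr_ge0 ?subr_ge0 ?(ltW h) //.
    apply: bigmax_le => // k hk; apply: ord; last exact: lt_le_trans (zy i).
    by apply: le_lt_trans hk.
  - by rewrite h subrr mulr0.
have -> : \sum_i (cost i - tau) * (z i - x i)
    = \sum_i cost i * z i - \sum_i cost i * x i - tau * (\sum_i z i - \sum_i x i).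
  rewrite -!sumrB mulr_sumr -sumrB; apply: eq_bigr => i _; ring.
by rewrite e subrr mulr0 subr0 subr_ge0.
Qed.

Section Splitting.
Variables (R : realType) (F C : finType).

(** A copy contains a function on clients, so [copy] has no decidable equality; hence [List.Forall]
    below instead of membership. *)
Definition copy_ok (p : copy R F C) : Prop :=
  forall j, 0 <= cp_x p j <= cp_y p.

Lemma split_runP (s s' : seq (copy R F C)) :
    split_run s s' -> List.Forall copy_ok s ->
  [/\ List.Forall copy_ok s',
      forall e : F -> R, \sum_(p <- s') cp_y p * e (cp_origin p)
                       = \sum_(p <- s) cp_y p * e (cp_origin p),
      forall (e : F -> R) j, \sum_(p <- s') cp_x p j * e (cp_origin p)
                           = \sum_(p <- s) cp_x p j * e (cp_origin p)
    & forall (k : 'I_(size s')) j,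
        ~~ (0 < cp_x (tnth (in_tuple s') k) j < cp_y (tnth (in_tuple s') k))].
Proof.
elim=> {s s'} [s hs|s1 p p1 p2 s2 s' [j [xj [o1 o2] [y1 y2] [x1 x2] hk]] _ IH] ok.
  by split.
have ok' : List.Forall copy_ok (s1 ++ p1 :: p2 :: s2).
  have [ok1 /List.Forall_cons_iff [_ ok2]] := proj1 (List.Forall_app _ _ _) ok.
  apply/List.Forall_app; split=> //.
  by do 2?[apply/List.Forall_cons_iff; split=> //]; move=> k; have [] := hk k.
have [h1 h2 h3 h4] := IH ok'; split=> // [e|e k].
  by rewrite h2 !big_cat !big_cons /= o1 o2 y1 y2; ring.
rewrite h3 !big_cat !big_cons /= o1 o2; have [<- _ _] := hk k; ring.
Qed.

Lemma Forall_tnth (P : copy R F C -> Prop) (s : seq (copy R F C)) :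
  List.Forall P s -> forall k : 'I_(size s), P (tnth (in_tuple s) k).
Proof.
move=> hs k; rewrite (tnth_nth (tnth (in_tuple s) k)) /=.
move: (tnth _ _) => p0; case: k => k /=.
by elim: hs k => // p s' hp _ IH [|k] //=; exact: IH.
Qed.

Lemma sum_tnth (s : seq (copy R F C)) (G : copy R F C -> R) :
  \sum_(k < size s) G (tnth (in_tuple s) k) = \sum_(p <- s) G p.
Proof. by rewrite [RHS]big_tnth. Qed.
End Splitting.

Lemma clusteringP (R : realType) (F C : finType) (c xb : F -> C -> R) (ys : F -> R)
    (U : {set C}) (K : seq C) :
    (forall j, close xb j != set0) -> clustering c xb ys U K ->
  [/\ disjoint_clusters xb K, {subset K <= U}
    & forall j, j \in U -> exists j', [/\ j' \in K,
        close xb j :&: close xb j' != set0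
      & D_av c xb ys j' + D_max c xb j' <= D_av c xb ys j + D_max c xb j]].
Proof.
move=> ne; elim=> {U K} [|U j K jU jmin _ [dK KU near]].
  by split=> // j; rewrite inE.
split.
- rewrite /disjoint_clusters pairwise_cons; apply/andP; split=> //; apply/allP => k /KU.
  by rewrite !inE negb_or negbK setI_eq0 => /andP[/andP[]].
- move=> k; rewrite inE => /orP[/eqP -> //|/KU].
  by rewrite inE => /andP[].
move=> k kU; case: (boolP (k \in j |: neighbors xb j)) => hk; last first.
  have [|j' [j'K h1 h2]] := near k; first by rewrite in_setD hk.
  by exists j'; split=> //; rewrite inE j'K orbT.
exists j; split; [by rewrite mem_head| |exact: jmin].
move: hk; rewrite !inE => /orP[/eqP ->|]; first by rewrite setIid.
by rewrite setIC.
Qed.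

(** The union bound. With a single nonzero share it shows that a facility is opened with probability
    at most that share. *)
Lemma block_prod_ge (R : realType) (I C : finType) (xb : I -> C -> R) (K : seq C)
    (v : I -> R) :
    disjoint_clusters xb K -> (forall i, 0 <= v i) -> block_le1 xb K v ->
  1 - \sum_i v i <= block_prod xb K v.
Proof.
move=> dK v0 [h1 h2]; rewrite (sum_clusters dK).
pose P (p s : R) := [/\ 0 <= p, p <= 1 & 1 - s <= p].
have P0 : P 1 0 by rewrite /P; split; lra.
have PM p s p' s' : P p s -> P p' s' -> P (p * p') (s + s').
  by move=> [p0 p1 ps] [p0' p1' ps']; split; nra.
have [] // : P (block_prod xb K v) (\sum_(j <- K) \sum_(i in close xb j) v i +
               \sum_(i | ~~ has (fun j => i \in close xb j) K) v i).
apply: (PM).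
  rewrite big_seq [X in P _ X]big_seq; apply: (big_ind2 P) => // j jK.
  have := h1 j jK; have : 0 <= \sum_(i in close xb j) v i by exact: sumr_ge0.
  by rewrite /P => *; split; lra.
apply: (big_ind2 P) => // i _; have := h2 i; have := v0 i.
by rewrite /P => *; split; lra.
Qed.

Lemma a1_opening_cost (R : realType) (I C : finType) (xb : I -> C -> R)
    (yb : I -> R) (K : seq C) (f : I -> R) :
    (forall i j, 0 <= xb i j) -> (forall i, 0 <= yb i) -> (forall i, 0 <= f i) ->
    disjoint_clusters xb K ->
    (forall j i, j \in K -> i \in close xb j -> xb i j = yb i) ->
    (forall j, j \in K -> \sum_(i in close xb j) xb i j = 1) ->
  \sum_(S : {set I}) opening_prob xb yb K S = 1 /\
  \sum_(S : {set I}) opening_prob xb yb K S * (\sum_(i in S) f i)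
    <= \sum_i f i * yb i.
Proof.
move=> x0 y0 f0 dK xyK x1K.
have gf v z : (forall i, cut01 (yb i) * (1 - z i) = v i) ->
    \sum_S opening_prob xb yb K S * \prod_(i in S) z i = block_prod xb K v.
  by move=> h; rewrite opening_probM // (opening_gf_block_prod x0 xyK x1K h).
have total : \sum_(S : {set I}) opening_prob xb yb K S = 1.
  have := gf (fun=> 0) (fun=> 1) (fun i => _).
  under eq_bigr do rewrite big1_eq mulr1.
  move=> -> => [|i]; last by rewrite subrr mulr0.
  rewrite /block_prod !big1 ?mulr1 // => [j _|j _]; first by rewrite subr0.
  by rewrite big1_eq subr0.
split=> //; under eq_bigr do rewrite mulr_sumr.
rewrite (exchange_big_dep xpredT) //=; apply: ler_sum => i _.
rewrite -mulr_suml mulrC ler_wpM2l //.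
(* With this [z] the generating function is the probability that [i] stays closed. *)
pose z k : R := if k == i then 0 else 1.
pose v k : R := if k == i then cut01 (yb i) else 0.
have /andP[c0 c1] := cut01_bounds (yb i).
have v0 k : 0 <= v k by rewrite /v; case: eqP.
have sv (A : {pred I}) : \sum_(k in A) v k <= cut01 (yb i).
  rewrite big_mkcond (bigD1 i) //= big1 => [|k /negbTE ki].
    by rewrite addr0 /v eqxx; case: ifP.
  by rewrite /v ki; case: ifP.
have zS (S : {set I}) : \prod_(k in S) z k = if i \in S then 0 else 1.
  case: ifP => iS; first by rewrite (bigD1 i) //= /z eqxx mul0r.
  rewrite big1 // => k kS; rewrite /z; case: eqP => // e.
  by rewrite -e kS in iS.
have := gf v z; rewrite (eq_bigr _ (fun S _ => congr1 _ (zS S))) => gfz.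
have -> : \sum_(S : {set I} | i \in S) opening_prob xb yb K S
    = 1 - block_prod xb K v.
  rewrite -gfz => [|k]; last first.
    by rewrite /v /z; case: eqP => [->|_]; rewrite ?subr0 ?mulr1 // subrr mulr0.
  rewrite -[X in X - _]total -sumrB big_mkcond /=; apply: eq_bigr => S _.
  by case: ifP => _; rewrite ?mulr0 ?subr0 ?mulr1 ?subrr.
have := block_prod_ge dK v0 _.
have ble : block_le1 xb K v.
  split=> [j _|k]; first by apply: le_trans (sv _) c1.
  by rewrite /v; case: eqP.
move=> /(_ ble); have := cut01_le (y0 i).
have := sv predT; rewrite /=; lra.
Qed.

(** * Expected cost of a run of A1 *)

Section A1.
Variables (R : realType) (F C : finType) (f : F -> R) (c : F -> C -> R).
Hypotheses (f_ge0 : forall i, 0 <= f i) (c_ge0 : forall i j, 0 <= c i j).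
Hypothesis c_metric : ufl_metric c.
Variables (g : R) (gP : is_gamma0 g).
Variables (x : F -> C -> R) (y : F -> R).
Hypothesis xy_feasible : lp_feasible x y.
Hypothesis y_ge0 : forall i, 0 <= y i.
Variables (s : seq (copy R F C)) (K : seq C).
Variable a : {set 'I_(size s)} -> C -> 'I_(size s).
Hypothesis run : a1_run c g y K a.

Let xb := sp_x (s := s).
Let yb := sp_y (s := s).
Let hh := sp_c c (s := s).
Let org (k : 'I_(size s)) : F := cp_origin (tnth (in_tuple s) k).
Let E : R := (expR 1)^-1.
Let u : R := expR (- g).

Let g_gt1 : 1 < g. Proof. exact: gamma0_gt1. Qed.
Let g_gt0 : 0 < g. Proof. by apply: lt_trans g_gt1. Qed.
Let g_le2 : g <= 2. Proof. by have := gamma0_le gP; lra. Qed.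
Let gy_ge0 i : 0 <= g * y i. Proof. by rewrite mulr_ge0 // ltW. Qed.

Lemma split_facts : exists xt : F -> C -> R,
  [/\ greedy_assignment c (fun i => g * y i) xt,
      forall k j, 0 <= xb k j <= yb k /\ (0 < xb k j -> xb k j = yb k),
      forall e : F -> R, \sum_k yb k * e (org k) = \sum_i g * y i * e i
    & forall (e : F -> R) j, \sum_k xb k j * e (org k) = \sum_i xt i j * e i].
Proof.
have [[xt greedy split] _ _] := run.
have ok0 : List.Forall (@copy_ok R F C) [seq Copy i (g * y i) (xt i) | i <- enum F].
  elim: (enum F) => [|i e IH] /=; first exact: List.Forall_nil.
  apply: List.Forall_cons => // j /=.
  by have [t [_ _ ->]] := greedy j; apply: greedy_fill_bounds.
have [ok sum_y sum_x fin] := split_runP split ok0.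
exists xt; split=> // [k j|e|e j].
- have /andP[h1 h2] := Forall_tnth ok k j.
  rewrite /xb /yb /sp_x /sp_y h1 h2; split=> // h3.
  apply/eqP; rewrite eq_le h2 /= leNgt.
  by apply/negP => h4; have := fin k j; rewrite h3 h4.
- by rewrite (sum_tnth s (fun p => cp_y p * e (cp_origin p))) sum_y big_map big_enum.
by rewrite (sum_tnth s (fun p => cp_x p j * e (cp_origin p))) sum_x big_map big_enum.
Qed.

Let xb_ge0 k j : 0 <= xb k j.
Proof. by have [xt [_ h _ _]] := split_facts; have [/andP[]] := h k j. Qed.

Let xb_sum j : \sum_k xb k j = 1.
Proof.
have [xt [greedy _ _ sx]] := split_facts.
transitivity (\sum_k xb k j * 1); first by apply: eq_bigr => k _; rewrite mulr1.
rewrite (sx (fun=> 1)); under eq_bigr do rewrite mulr1.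
have [t [pt _ h]] := greedy j; have [x1 xy x0] := xy_feasible.
under eq_bigr do rewrite h.
rewrite -big_enum -(perm_big _ pt) /=; apply: greedy_fill_sum => //.
  by rewrite (perm_uniq pt) enum_uniq.
rewrite ler01 (perm_big _ pt) big_enum /= -mulr_sumr.
have : \sum_i y i >= 1 by rewrite -(x1 j); apply: ler_sum => i _; exact: xy.
by have := g_gt1; nra.
Qed.

Let xb_close j k : k \in close xb j -> xb k j = yb k.
Proof.
by rewrite inE; have [xt [_ h _ _]] := split_facts; have [_] := h k j.
Qed.

Let sum_close j (e : 'I_(size s) -> R) :
  \sum_(k in close xb j) xb k j * e k = \sum_k xb k j * e k.
Proof.
rewrite [RHS](bigID (mem (close xb j))) /= [X in _ = _ + X]big1 ?addr0 // => k.
rewrite inE -leNgt => h; have -> : xb k j = 0 by apply/eqP; rewrite eq_le h xb_ge0.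
by rewrite mul0r.
Qed.

Let x1K j : \sum_(k in close xb j) xb k j = 1.
Proof.
rewrite -(xb_sum j); have := sum_close j (fun=> 1).
by under eq_bigr do rewrite mulr1; under [X in _ = X -> _]eq_bigr do rewrite mulr1.
Qed.

Let Dav j := \sum_k xb k j * hh k j.

Let D_avE j : D_av hh xb (fun k => yb k / g) j = Dav j.
Proof.
rewrite /D_av.
have -> : \sum_(k in close xb j) yb k / g = g^-1.
  rewrite -mulr_suml -[RHS]mul1r -(x1K j); congr (_ * _).
  by apply: eq_bigr => k /xb_close.
rewrite invrK /Dav -(sum_close j (fun k => hh k j)) mulr_suml; apply: eq_bigr => k kj.
by rewrite (xb_close kj) mulrA mulfVK ?gt_eqF // mulrC.
Qed.

Let close_neq0 j : close xb j != set0.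
Proof.
by apply: contra_eq_neq (x1K j) => ->; rewrite big_set0 eq_sym oner_eq0.
Qed.

Let centers : disjoint_clusters xb K /\ forall j, exists j', [/\ j' \in K,
  close xb j :&: close xb j' != set0
  & Dav j' + D_max hh xb j' <= Dav j + D_max hh xb j].
Proof.
have [_ cl _] := run; have [dK _ near] := clusteringP close_neq0 cl.
split=> // j; have [j' [h1 h2 h3]] := near j (in_setT j).
by exists j'; split=> //; rewrite -!D_avE.
Qed.

Lemma distant_shares j : exists d : 'I_(size s) -> R, exists Dd,
  [/\ forall k, 0 <= d k, forall k, xb k j + d k <= yb k, \sum_k d k = g - 1,
      forall k l, 0 < xb k j -> 0 < d l -> hh k j <= hh l j
    & Dd * (g - 1) = \sum_k d k * hh k j /\
      Dav j + (g - 1) * Dd <= g * \sum_i c i j * x i j].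
Proof.
have [xt [greedy xbP sy sx]] := split_facts.
have [t [pt srt h]] := greedy j; have [x1 xy x0] := xy_feasible.
have ut : uniq t by rewrite (perm_uniq pt) enum_uniq.
have tr : transitive (fun i k : F => c i j <= c k j) by move=> ? ? ?; exact: le_trans.
have rf : reflexive (fun i k : F => c i j <= c k j) by move=> ?; exact: lexx.
have mt i : i \in t by rewrite (perm_mem pt) mem_enum.
pose x2 := greedy_fill (fun i => g * y i) t g.
have x2_bounds i : 0 <= x2 i <= g * y i by apply: greedy_fill_bounds => //; exact: ltW.
have xt_le i : xt i j <= x2 i by rewrite h; apply: greedy_fill_le; exact: ltW.
have sumF (e : F -> R) : \sum_(k <- t) e k = \sum_i e i.
  by rewrite (perm_big _ pt) big_enum.
have x2_sum : \sum_i x2 i = g.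
  rewrite -sumF greedy_fill_sum // ltW //= sumF -mulr_sumr.
  by rewrite ler_peMr ?(ltW g_gt0) // -(x1 j) ler_sum.
have xt_sum : \sum_i xt i j = 1.
  rewrite -(xb_sum j); have := sx (fun=> 1) j.
  by under eq_bigr do rewrite mulr1; under [X in _ = X -> _]eq_bigr do rewrite mulr1.
pose room i := g * y i - xt i j.
pose dF i := x2 i - xt i j.
have dF0 i : 0 <= dF i by rewrite subr_ge0.
have dF_room i : dF i <= room i by rewrite lerB //; have /andP[] := x2_bounds i.
pose del i := dF i / room i.
have room0 i : 0 <= room i by exact: le_trans (dF_room i).
have del0 i : 0 <= del i by rewrite divr_ge0.
have roomE i : room i * del i = dF i.
  rewrite mulrCA; case: (eqVneq (room i) 0) => [e|ne]; last by rewrite divff ?mulr1.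
  by rewrite e mul0r mulr0; apply/eqP; rewrite eq_le dF0 -e dF_room.
have del1 i : del i <= 1.
  case: (eqVneq (room i) 0) => [e|ne]; first by rewrite /del e invr0 mulr0 ler01.
  by rewrite ler_pdivrMr ?mul1r ?dF_room // lt_neqAle eq_sym ne room0.
pose d k := (yb k - xb k j) * del (org k).
have sum_d (e : F -> R) : \sum_k d k * e (org k) = \sum_i dF i * e i.
  transitivity (\sum_k (yb k * (del (org k) * e (org k)) -
                        xb k j * (del (org k) * e (org k)))).
    by apply: eq_bigr => k _; rewrite /d; ring.
  rewrite sumrB (sy (fun i => del i * e i)) (sx (fun i => del i * e i)) -sumrB.
  by apply: eq_bigr => i _; rewrite -roomE /room; ring.
have g1 : 0 < g - 1 by rewrite subr_gt0.
exists d, ((\sum_k d k * hh k j) / (g - 1)).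
have ybx k : 0 <= yb k - xb k j by rewrite subr_ge0; have [/andP[]] := xbP k j.
split.
- by move=> k; rewrite mulr_ge0.
- move=> k; have := ler_wpM2l (ybx k) (del1 (org k)); rewrite /d; lra.
- have := sum_d (fun=> 1); under eq_bigr do rewrite mulr1.
  move=> ->; under eq_bigr do rewrite mulr1.
  by rewrite sumrB x2_sum xt_sum.
- move=> k l xk dl.
  have xtk : 0 < xt (org k) j.
    have := sx (fun i => (i == org k)%:R) j.
    rewrite [X in _ = X](bigD1 (org k)) //= eqxx mulr1 [X in _ = _ + X]big1; last first.
      by move=> i /negbTE ->; rewrite mulr0.
    rewrite addr0 => <-; rewrite (bigD1 k) //= eqxx mulr1.
    by rewrite ltr_wpDr // sumr_ge0 // => i _; rewrite mulr_ge0.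
  have dFl : 0 < dF (org l).
    rewrite lt_neqAle dF0 andbT; apply: contraTN dl => /eqP e.
    by rewrite /d /del -e mul0r mulr0 ltxx.
  rewrite h in xtk; apply: (greedy_fill_order gy_ge0 tr rf srt ut ler01 (mt _) xtk).
  rewrite -h; have /andP[_] := x2_bounds (org l); move: dFl; rewrite /dF; lra.
split; first by rewrite divfK ?gt_eqF.
rewrite mulrCA divff ?gt_eqF // mulr1.
rewrite /Dav (sx (fun i => c i j)) (sum_d (fun i => c i j)) -big_split /=.
rewrite (eq_bigr (fun i => c i j * x2 i)) => [|i _]; last by rewrite /dF; ring.
have -> : g * \sum_i c i j * x i j = \sum_i c i j * (g * x i j).
  by rewrite mulr_sumr; apply: eq_bigr => i _; ring.
(* Greedy filling to total g is cheapest, and g x is another filling with the same total and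
   capacities. *)
apply: (exchange_optimal (yt := fun i => g * y i)) => //.
- by move=> i; have /andP[] := x2_bounds i.
- by move=> i; rewrite ler_pM2l.
- by move=> i; rewrite mulr_ge0 // ltW.
- by move=> i l; apply: (greedy_fill_order gy_ge0 tr rf srt ut (ltW g_gt0) (mt _)).
by rewrite x2_sum -mulr_sumr x1 mulr1.
Qed.
Lemma a1_connection j :
  \sum_(S : {set 'I_(size s)}) opening_prob xb yb K S * hh (a S j) j
    <= (1 + 2 * u) * \sum_i c i j * x i j.
Proof.
have [dK near] := centers; have [j' [j'K meet val]] := near j.
have [k0 /setIP[k0j k0j']] := set0Pn _ meet.
have [d [Dd [d0 xd sd nf [dh opt]]]] := distant_shares j.
have [xt [_ xbP _ _]] := split_facts.
have h0 k l : 0 <= hh k l by exact: c_ge0.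
pose H := D_max hh xb j; pose M := D_max hh xb j'.
have le_max k l : k \in close xb l -> hh k l <= D_max hh xb l.
  exact: (@le_bigmax_cond _ _ _ _ k (fun k => k \in close xb l)).
have nearH k : 0 < xb k j -> hh k j <= H.
  by move=> h; apply: le_max; rewrite inE.
have farH l : 0 < d l -> H <= hh l j.
  move=> h; apply: bigmax_le => // k; rewrite inE => hk; exact: nf.
have g1 : 0 < g - 1 by rewrite subr_gt0.
have HD : H <= Dd.
  rewrite -(ler_pM2r g1) dh -sd mulr_sumr; apply: ler_sum => l _.
  rewrite mulrC; have := d0 l; rewrite le_eqVlt => /orP[/eqP <-|dl].
    by rewrite !mul0r.
  by rewrite ler_pM2l // farH.
have x_le1 k : xb k j <= 1.
  by rewrite -(xb_sum j) (bigD1 k) //= lerDl sumr_ge0.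
have xd1 k : xb k j + d k <= 1.
  (* A copy close to [j] is used up by it; any other copy carries only a distant share, at most g -
     1 <= 1. *)
  have := xb_ge0 k j; rewrite le_eqVlt => /orP[/eqP <-|xk].
    rewrite add0r; have : d k <= g - 1.
      by rewrite -sd (bigD1 k) //= lerDl sumr_ge0.
    by have := g_le2; lra.
  have [_ /(_ xk) e] := xbP k j; have := xd k; have := x_le1 k; rewrite -e; lra.
have M0 : 0 <= M by exact: bigmax_ge_id.
have D'0 : 0 <= Dav j' by apply: sumr_ge0 => k _; rewrite mulr_ge0.
have y1 : \sum_(k in close xb j') yb k = 1.
  by rewrite -(x1K j'); apply: eq_bigr => k /xb_close.
have yh : \sum_(k in close xb j') yb k * hh k j' = Dav j'.
  rewrite /Dav -(sum_close j' (fun k => hh k j')).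
  by apply: eq_bigr => k /xb_close ->.
have x0j : 0 < xb k0 j by move: k0j; rewrite inE.
have fb := @fallback_distance R _ (close xb j') g H M (Dav j') Dd yb (xb^~ j) d
  (hh^~ j) (hh^~ j') k0 g_le2 (fun k => xb_ge0 k j) d0 xd y1 yh
  (fun k hk => le_max k j' hk) (fun k l => c_metric (org k) (org l) j j')
  nearH farH sd dh HD k0j' x0j.
have cost_le (S : {set 'I_(size s)}) k : k \in S -> hh (a S j) j <= hh k j.
  have [_ _ ac] := run => kS.
  have [|_ h] := ac S j; last exact: h.
  by apply/set0Pn; exists k.
have Dd_le : Dd <= Dd + M + Dav j' by lra.
have := @expected_distance R _ C xb yb K xb_ge0 dK
  (fun j i _ h => xb_close h) (fun j _ => x1K j) g H (Dd + M + Dav j') Dd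
  (hh^~ j) (xb^~ j) d j' (fun S => hh (a S j) j) g_gt1 (fun k => h0 k j)
  (fun k => xb_ge0 k j) d0 xd xd1 (xb_sum j) sd nearH farH dh Dd_le j'K fb cost_le.
move=> /le_trans; apply; rewrite -/E -/u -/(Dav j).
have g_eq : E + u = (g - 1) * (1 - E + u) by exact: gamma0_eq.
have u0 : 0 < u by exact: expRN_gamma0_gt0.
have E1 : 0 < 1 - E.
  by have /andP[_] := invr_expR1_bounds R; rewrite -/E; lra.
(* The center was picked for its small sum of average and maximum, and H <= Dd. *)
have : u * (M + Dav j') <= u * (Dd + Dav j).
  by rewrite ler_pM2l //; move: val; rewrite -/H -/M; lra.
have := ler_wpM2l (ltW (addr_gt0 E1 u0)) opt.
set X := \sum_i c i j * x i j.
have -> : (1 - E + u) * (g * X) = (1 + 2 * u) * X.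
  have -> : (1 - E + u) * (g * X) = ((g - 1) * (1 - E + u) + (1 - E + u)) * X by ring.
  by rewrite -g_eq; ring.
(* The role of gamma0: the coefficients 1 - E + u and E + u of [Dav j] and [Dd] are in ratio 1 : g -
   1, exactly the combination that [opt] bounds. *)
have -> : (1 - E + u) * (Dav j + (g - 1) * Dd) = (1 - E + u) * Dav j + (E + u) * Dd.
  by rewrite g_eq; ring.
lra.
Qed.

Lemma a1_expected_cost (j0 : C) :
  [/\ forall S, 0 <= opening_prob xb yb K S,
      \sum_(S : {set 'I_(size s)}) opening_prob xb yb K S = 1
    & \sum_(S : {set 'I_(size s)}) opening_prob xb yb K S *
        solution_cost (sp_f f (s := s)) hh S (a S)
      <= g * facility_cost f y + (1 + 2 * u) * connection_cost c x].
Proof.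
have [dK _] := centers; have [xt [_ xbP sy _]] := split_facts.
have yb0 k : 0 <= yb k.
  by have [/andP[h1 h2] _] := xbP k j0; exact: le_trans h2.
have [tot open] := @a1_opening_cost R _ C xb yb K (sp_f f (s := s)) xb_ge0 yb0
  (fun k => f_ge0 _) dK (fun j i _ h => xb_close h) (fun j _ => x1K j).
split=> //; first by move=> S; exact: opening_prob_ge0.
rewrite /solution_cost.
under eq_bigr do rewrite mulrDr.
rewrite big_split /=; apply: lerD.
  apply: le_trans open _.
  rewrite /facility_cost (eq_bigr (fun k => yb k * f (org k))) => [|k _]; last first.
    by rewrite mulrC.
  by rewrite sy mulr_sumr; apply: ler_sum => i _; rewrite -mulrA (mulrC (y i)).
under eq_bigr do rewrite mulr_sumr.
rewrite exchange_big /= /connection_cost [X in _ <= _ * X]exchange_big /= mulr_sumr.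
by apply: ler_sum => j _; exact: a1_connection.
Qed.
End A1.

(** * Combining the two algorithms *)

Lemma lp_y_ge0 (R : realType) (F C : finType) (x : F -> C -> R) (y : F -> R) (j : C) :
  lp_feasible x y -> forall i, 0 <= y i.
Proof. by move=> [_ xy x0] i; exact: le_trans (xy i j). Qed.

(** Without clients [y] is unconstrained, so a positive opening cost would make the LP unbounded
    below. *)
Lemma lp_optimal_no_client (R : realType) (F C : finType) (f : F -> R)
    (c : F -> C -> R) (x : F -> C -> R) (y : F -> R) :
    (forall i, 0 <= f i) -> (C -> False) -> lp_optimal f c x y -> forall i, f i = 0.
Proof.
move=> f0 noC [_ opt] i.
have /opt : lp_feasible x (fun k => y k - (k == i)%:R).
  by split=> // [j|k j|k j]; case: (noC j).
rewrite lerD2l /facility_cost => h; apply/eqP; rewrite eq_le f0 andbT.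
move: h; rewrite -subr_ge0 -sumrB.
rewrite (bigD1 i) //= eqxx big1 => [|k /negbTE ->]; last by rewrite subr0 subrr.
by rewrite addr0 mulr1n mulrBr mulr1 addrAC subrr sub0r oppr_ge0.
Qed.

Theorem theorem2 (R : realType) (F C : finType)
    (f : F -> R) (c : F -> C -> R)
    (f_ge0 : forall i, 0 <= f i)
    (c_ge0 : forall i j, 0 <= c i j)
    (c_metric : ufl_metric c)
    (gamma0 : R) (gamma0P : is_gamma0 gamma0)
    (x : F -> C -> R) (y : F -> R) (xy_opt : lp_optimal f c x y)
    (s : seq (copy R F C)) (K : seq C)
    (a : {set 'I_(size s)} -> C -> 'I_(size s))
    (A1 : a1_run c gamma0 y K a)
    (SJ : {set F}) (aJ : C -> F) (JMS : jms_run f c SJ aJ) :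
  \sum_(S : {set 'I_(size s)})
      opening_prob (sp_x (s := s)) (sp_y (s := s)) K S *
      Num.min (solution_cost (sp_f f (s := s)) (sp_c c (s := s)) S (a S))
              (solution_cost f c SJ aJ)
    <= 3 / 2 * (facility_cost f y + connection_cost c x).
Proof.
have [xy_feas _] := xy_opt.
have [j0 _|noC] := pickP (fun _ : C => true); last first.
  have {}noC (j : C) : False by have := noC j.
  have f0 := lp_optimal_no_client f_ge0 noC xy_opt.
  have sum0 (e : C -> R) : \sum_j e j = 0 by rewrite big1 // => j; case: (noC j).
  have cost0 (I : finType) (e : I -> R) (d : I -> C -> R) (S : {set I}) b :
      (forall i, e i = 0) -> solution_cost e d S b = 0.
    by move=> e0; rewrite /solution_cost sum0 addr0 big1.
  rewrite big1 => [|S _].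
    rewrite mulr_ge0 ?divr_ge0 // addr_ge0 // sumr_ge0 // => i _.
      by rewrite f0 mul0r.
    by rewrite sum0.
  rewrite !cost0 ?minxx ?mulr0 // => k; exact: f0.
have y0 := lp_y_ge0 j0 xy_feas.
have [pos tot costA] :=
  a1_expected_cost f_ge0 c_ge0 c_metric gamma0P xy_feas y0 A1 j0.
have costJ := jms_bifactor f_ge0 c_ge0 c_metric xy_feas y0 JMS.
set J := solution_cost f c SJ aJ in costJ *.
have F0 : 0 <= facility_cost f y by apply: sumr_ge0 => i _; rewrite mulr_ge0.
have C0 : 0 <= connection_cost c x.
  have [_ _ x0] := xy_feas.
  by apply: sumr_ge0 => i _; apply: sumr_ge0 => j _; rewrite mulr_ge0.
(* For every [S] the minimum is at most the convex combination of the two costs, and the JMS cost is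
   constant under the opening probabilities, which sum to 1. *)
have mix : \sum_(S : {set 'I_(size s)})
      opening_prob (sp_x (s := s)) (sp_y (s := s)) K S *
      Num.min (solution_cost (sp_f f (s := s)) (sp_c c (s := s)) S (a S)) J
  <= 11 / 16 * (gamma0 * facility_cost f y
                + (1 + 2 * expR (- gamma0)) * connection_cost c x) + 5 / 16 * J.
  apply: le_trans (lerD (ler_wpM2l _ costA) (lexx (5 / 16 * J))); last by lra.
  have -> : 5 / 16 * J = \sum_S opening_prob (sp_x (s := s)) (sp_y (s := s)) K S
                          * (5 / 16 * J) by rewrite -mulr_suml tot mul1r.
  rewrite mulr_sumr -big_split /=; apply: ler_sum => S _.
  rewrite mulrCA -mulrDr ler_wpM2l ?pos //.
  set A := solution_cost _ _ S _.
  by rewrite ge_min; case: (leP A J) => h; apply/orP; [left|right]; lra.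
have hg := gamma0_le gamma0P; have hu := expRN_gamma0_le gamma0P.
have := ler_wpM2r F0 hg; have := ler_wpM2r C0 hu; lra.
Qed.
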